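(* Let $k\ge 1$ and $n\ge k+2$ be integers. Then $$ g_k(n)= \max\left\{ \left\lfloor\frac{(k+1)n}{2}\right\rfloor,\; \max_{\substack{a\in\mathbb Z\\ \left\lfloor (k+1)/2\right\rfloor+1\le a\le k+1}} \left\{ a(n-a)+ \left\lfloor\frac{a(k+1-a)}{2}\right\rfloor \right\} \right\}. $$
   Context: All graphs are finite and simple. A chord of a cycle $C$ in a graph $G$ is an edge of $G$ joining two vertices of $C$ that are not consecutive on $C$. For integers $k\ge1$ and $n\ge k+2$, $g_k(n)$ denotes the maximum number of edges in an $n$-vertex graph containing no cycle $C$ with a vertex (of $C$) incident with at least $k$ chords of $C$. *)

(* Defs.v *)
From mathcomp Require Import all_boot.

Set Implicit Arguments.
Unset Strict Implicit.
Unset Printing Implicit Defensive.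

Section Graph.
Variable T : finType.
Implicit Types (E : {set {set T}}) (c : seq T) (v : T) (k : nat).

(* A finite simple graph on the vertex set T is given by its edge set. *)
Definition simple_graph E := [forall e in E, #|e| == 2].

Definition adj E : rel T := fun x y => [set x; y] \in E.

(* c lists the vertices of a cycle in cyclic order, without repetition. *)
Definition is_cycle E c := (2 < size c) && ucycleb (adj E) c.

Definition cycle_edges c : {set {set T}} := [set [set x; next c x] | x in c].

(* As edges are pairs of distinct vertices, excluding [cycle_edges c] excludes
   exactly the pairs of vertices that are consecutive on c. *)
Definition chords E c : {set {set T}} :=
  [set e in E | (e \subset c) && (e \notin cycle_edges c)].

Definition chords_at E c v : {set {set T}} := [set e in chords E c | v \in e].

Definition rich_cycle k E c :=
  is_cycle E c && [exists v in c, k <= #|chords_at E c v|].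

(* Cycles have no repeated vertex, so bounding their length by #|T| loses
   nothing and keeps the property decidable: see [has_rich_cycleP]. *)
Definition has_rich_cycle k E :=
  [exists m : 'I_#|T|.+1, exists c : m.-tuple T, rich_cycle k E c].

Lemma has_rich_cycleP k E :
  reflect (exists c, rich_cycle k E c) (has_rich_cycle k E).
Proof.
apply: (iffP existsP) => [[m /existsP[c cP]]|[c cP]]; first by exists c.
have cT : size c < #|T|.+1.
  by case/andP: cP => /and3P[_ _ /card_uniqP <-] _; rewrite ltnS max_card.
by exists (Ordinal cT); apply/existsP; exists (in_tuple c).
Qed.

End Graph.

(* The edgeless graph is always admissible, so this is a maximum over
   a nonempty family. *)
Definition g (k n : nat) : nat :=
  \max_(E : {set {set 'I_n}} | simple_graph E && ~~ has_rich_cycle k E) #|E|.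

(* Main.v *)
Require Import Defs.
From mathcomp Require Import all_boot.
From mathcomp Require Import zify.

Set Implicit Arguments.
Unset Strict Implicit.
Unset Printing Implicit Defensive.

(* Put d = k + 1.  The hypothesis says that a vertex of a cycle has at most d
   neighbours on that cycle.

   Upper bound, by minimal counterexample V with n vertices.  Deleting a set W
   of w <= n/2 vertices must destroy more than N w / 2 edges, N = ceil(n/2)
   ([dense]).  Let C be a longest cycle.  Rotating a path that cannot leave its own vertex set yields a set W
   that violates density or a cycle too long to fit beside C, so paths outside C
   have ends attached to C.  If such a path has p >= 3 vertices, the gaps on C
   between the attachments of its two ends make |C| + p exceed n.  Hence only
   single vertices and edges lie outside C.  Let s be the largest number of
   neighbours on C of a vertex w outside C: the successors on C of the
   neighbours of w have pairwise degree sums at most |C| (otherwise C + w would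
   have a Hamiltonian cycle), and summing degrees gives the bound, with a = s,
   a = d, or the d n / 2 term.

   Lower bound: a nearly d-regular graph, and the join of a nearly
   (d - a)-regular graph on a vertices with an independent set. *)

(** * Sequences as cycles *)

Ltac nat_hyps := repeat match goal with
  | H : ?P |- _ => lazymatch type of P with Prop => lazymatch P with
    | is_true (leq _ _) => fail
    | is_true (leq _ _ && leq _ _) => fail
    | @eq nat _ _ => fail
    | _ => clear H
    end end
  end.
Ltac lia_nat := nat_hyps; lia.

Section Sequences.
Variable T : finType.
Implicit Types (s q : seq T) (x y u v : T).

(** A duplicate-free sequence has length at most [#|T|], so the attained values of [f] form a
    decidable bounded set. Extremal paths and cycles are all chosen this way. *)
Lemma argmax_uniq (P : pred (seq T)) (f : seq T -> nat) M s0 :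
  (forall s, P s -> uniq s) -> (forall s, P s -> f s <= M) -> P s0 ->
  exists2 s, P s & forall t, P t -> f t <= f s.
Proof.
move=> Pu PM Ps0.
pose Q m := [exists k : 'I_#|T|.+1, exists t : k.-tuple T, P t && (f t == m)].
have QP s : P s -> Q (f s).
  move=> Ps; have sT : size s < #|T|.+1.
    by rewrite ltnS -(card_uniqP (Pu _ Ps)) max_card.
  apply/existsP; exists (Ordinal sT); apply/existsP; exists (in_tuple s).
  by rewrite /= Ps eqxx.
have Qex : exists m, Q m by exists (f s0); apply: QP.
have QM m : Q m -> m <= M.
  by case/existsP=> k /existsP[t /andP[Pt /eqP <-]]; apply: PM.
case: (ex_maxnP Qex QM) => m /existsP[k /existsP[t /andP[Pt /eqP ftm]]] mmax.
by exists t => // s /QP/mmax; rewrite ftm.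
Qed.

Lemma next_cat_cons s1 s2 u v :
  uniq (s1 ++ u :: v :: s2) -> next (s1 ++ u :: v :: s2) u = v.
Proof.
move=> us; rewrite -(next_rot (size s1) us) rot_size_cat /=.
by rewrite eqxx.
Qed.

Lemma next_last y s : uniq (y :: s) -> next (y :: s) (last y s) = y.
Proof.
case: (lastP s) => [|s' x] us; first by rewrite /= eqxx.
rewrite last_rcons -rcons_cons -(next_rotr 1) -?rcons_cons // rotr1_rcons /=.
by rewrite eqxx.
Qed.

Lemma last_or_next y s u : u \in y :: s ->
  u = last y s \/ exists s1 v s2, y :: s = s1 ++ u :: v :: s2.
Proof.
case/splitPr def_s: {1}_ / => [s1 [|v s2]]; last first.
  by right; exists s1, v, s2.
by left; rewrite -(last_cons y) def_s cats1 last_rcons.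
Qed.

Lemma iter_next_nth y s j :
  uniq (y :: s) -> j < size (y :: s) -> iter j (next (y :: s)) y = nth y (y :: s) j.
Proof.
move=> us; elim: j => [|j IH] // js.
rewrite iterS IH ?(ltnW js) // next_nth mem_nth ?(ltnW js) //.
by rewrite index_uniq ?(ltnW js).
Qed.

Lemma next_inj s : uniq s -> injective (next s).
Proof. by move=> us; apply: can_inj (prev_next us). Qed.

Lemma mem_iter_next s j x : (iter j (next s) x \in s) = (x \in s).
Proof. by elim: j => //= j IH; rewrite mem_next. Qed.

Lemma iter_next_neq s x j : uniq s -> x \in s -> 0 < j < size s ->
  iter j (next s) x != x.
Proof.
move=> us /rot_to[i s' def_s] /andP[j0 js].
have us' : uniq (x :: s') by rewrite -def_s rot_uniq.
have -> : iter j (next s) x = iter j (next (x :: s')) x.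
  by apply: eq_iter => z; rewrite -def_s next_rot.
have sz : size (x :: s') = size s by rewrite -def_s size_rot.
rewrite iter_next_nth ?sz //.
have -> : (nth x (x :: s') j != x) = (j != 0).
  by rewrite -(nth_uniq x _ _ us') ?sz //; lia.
by rewrite -lt0n.
Qed.

(** The arcs of [g z] vertices starting at the points of [Z] are disjoint: if two met, cancelling
    the smaller number of steps would put one start strictly inside the other arc. *)
Lemma gap_sum s (Z : {set T}) (g : T -> nat) :
    uniq s -> {subset Z <= s} ->
    (forall z j, z \in Z -> 0 < j < g z -> iter j (next s) z \notin Z) ->
  \sum_(z in Z) g z <= size s.
Proof.
move=> us Zs gP; pose O z := if z \in Z then [set iter (j : nat) (next s) z | j : 'I_(g z)]
  else set0.
have iter_inj j : injective (iter j (next s)).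
  by elim: j => //= j IH x y /(next_inj us)/IH.
have key z z' j k : z \in Z -> z' \in Z -> j <= k -> k < g z' ->
    iter j (next s) z = iter k (next s) z' -> j = k /\ z = z'.
  move=> zZ z'Z jk kg; rewrite -{1}(subnKC jk) iterD => /iter_inj def_z.
  have [jk'|] := eqVneq j k.
    by split=> //; rewrite def_z jk' subnn.
  move=> neq; have := gP z' (k - j) z'Z; rewrite -def_z zZ => H.
  by suff: false by []; apply: H; lia.
have cardO z : z \in Z -> #|O z| = g z.
  move=> zZ; rewrite /O zZ card_in_imset ?card_ord // => j k _ _ /= jk.
  apply: val_inj => /=; case: (leqP j k) => [le|/ltnW le].
    by case: (key z z j k zZ zZ le (ltn_ord k) jk).
  by case: (key z z k j zZ zZ le (ltn_ord j) (esym jk)).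
have -> : \sum_(z in Z) g z = \sum_z #|O z|.
  rewrite [RHS](bigID (mem Z)) /= [X in _ + X]big1 ?addn0 => [|z /negPf zZ].
    by apply: eq_bigr => z /cardO.
  by rewrite /O zZ cards0.
have disj z z' : z != z' -> [disjoint O z & O z'].
  move=> neq; rewrite disjoint_subset; apply/subsetP=> x; rewrite /O inE.
  case: ifP => zZ; last by rewrite inE.
  case/imsetP=> j _ ->; case: ifP => z'Z; last by rewrite inE.
  apply/negP=> /imsetP[k _ jk]; case: (leqP j k) => [le|/ltnW le].
    by case: (key z z' j k zZ z'Z le (ltn_ord k) jk) => _ /eqP; apply/negP.
  case: (key z' z k j z'Z zZ le (ltn_ord j) (esym jk)) => _ /eqP.
  by rewrite eq_sym; apply/negP.
have -> : \sum_z #|O z| = #|\bigcup_z O z|.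
  rewrite -sum1_card partition_disjoint_bigcup //=.
  by apply: eq_bigr => z _; rewrite sum1_card.
rewrite -(card_uniqP us); apply: subset_leq_card; apply/subsetP=> x.
case/bigcupP=> z _; rewrite /O; case: ifP => zZ; last by rewrite inE.
by case/imsetP=> j _ ->; rewrite mem_iter_next Zs.
Qed.

End Sequences.

(** * Rotations of paths *)

Section Paths.
Variables (T : finType) (e : rel T).
Hypotheses (esym : symmetric e) (eirr : irreflexive e).
Implicit Types (s q c : seq T) (x y z u v w : T) (S V W A B : {set T}).

(** Degrees are relative to a vertex set, so induced subgraphs of one fixed graph are just sets;
    [vol S] is twice the number of edges inside [S]. *)
Definition nbs S v := [set u in S | e v u].
Definition vol S := \sum_(v in S) #|nbs S v|.
Definition cyc c := (2 < size c) && ucycleb e c.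

Lemma cycP c : reflect [/\ 2 < size c, uniq c & cycle e c] (cyc c).
Proof. by apply: (iffP and3P) => -[]; split. Qed.

Lemma nbs_neq S v u : u \in nbs S v -> u != v.
Proof. by rewrite inE => /andP[_]; apply: contraTneq => ->; rewrite eirr. Qed.

Lemma nbsS S V v : S \subset V -> nbs S v \subset nbs V v.
Proof.
by move=> /subsetP SV; apply/subsetP=> u; rewrite !inE => /andP[/SV -> ->].
Qed.

Lemma card_nbs_sum S v : #|nbs S v| = \sum_(u in S) e v u.
Proof.
rewrite -sum1dep_card big_mkcondr; apply: eq_bigr => u _.
by case: (e v u).
Qed.

Lemma card_nbs_split S W v : W \subset S ->
  #|nbs S v| = #|nbs W v| + #|nbs (S :\: W) v|.
Proof.
move=> WS; rewrite -(cardsID W (nbs S v)).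
congr (_ + _); apply: eq_card => u; rewrite !inE ?andbA //.
have := subsetP WS u.
by case: (u \in W) => [->|_]; rewrite ?andbT ?andbF.
Qed.

Lemma sum_nbs_exchange A B :
  \sum_(v in A) #|nbs B v| = \sum_(v in B) #|nbs A v|.
Proof.
under eq_bigr do rewrite card_nbs_sum.
rewrite exchange_big /=; apply: eq_bigr => u _; rewrite card_nbs_sum.
by apply: eq_bigr => v _; rewrite esym.
Qed.

(** The sum is twice the number of edges lost with [W]: an edge inside [W] counts once at each end,
    an edge leaving [W] twice at its end in [W]. *)
Lemma vol_split V W : W \subset V ->
  vol V = vol (V :\: W) + \sum_(w in W) (#|nbs V w| + #|nbs (V :\: W) w|).
Proof.
move=> WV; rewrite {1}/vol (big_setID W) /= (setIidPr WV) addnC.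
have -> : \sum_(v in V :\: W) #|nbs V v|
        = vol (V :\: W) + \sum_(w in W) #|nbs (V :\: W) w|.
  under eq_bigr do rewrite (card_nbs_split _ WV).
  by rewrite big_split /= addnC sum_nbs_exchange.
by rewrite -addnA; congr (_ + _); rewrite big_split addnC.
Qed.

Lemma card_nbs_lt S v : v \in S -> #|nbs S v| < #|S|.
Proof.
move=> vS; rewrite [X in _ < X](cardsD1 v) vS add1n ltnS; apply: subset_leq_card.
apply/subsetP=> u uN; rewrite !inE (nbs_neq uN).
by move: uN; rewrite inE => /andP[].
Qed.

Lemma sorted_cat_cons s1 y s :
  sorted e (s1 ++ y :: s) = sorted e (rcons s1 y) && path e y s.
Proof. by case: s1 => //= x s1; rewrite cat_path rcons_path /= andbA. Qed.

Lemma sorted_rev s : sorted e (rev s) = sorted e s.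
Proof. by rewrite rev_sorted; case: s => //= x s; apply: eq_path => u v; apply: esym. Qed.

Lemma rev_path_ends w t : path e w t -> exists w' t',
  [/\ rev (w :: t) = w' :: t', path e w' t', w' = last w t & last w' t' = w].
Proof.
move=> pwt; have [w' [t' def_t]] : exists w' t', rev (w :: t) = w' :: t'.
  by rewrite lastI rev_rcons; eexists; eexists.
exists w', t'; split=> //.
- have : sorted e (rev (w :: t)) by rewrite sorted_rev.
  by rewrite def_t.
- by rewrite -[w']/(head w (w' :: t')) -def_t lastI rev_rcons.
- by rewrite -(last_cons w) -def_t rev_cons last_rcons.
Qed.

Lemma path_rotate u v s :
  path e v s -> e (last v s) u -> path e u (rev (v :: s)).
Proof.
move=> pvs elu; rewrite -[path _ _ _]/(sorted e (u :: rev (v :: s))).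
by rewrite -rev_rcons sorted_rev /= rcons_path pvs.
Qed.

Lemma has_nbs_last y s : path e y s -> 0 < size s ->
  exists2 u, u \in y :: s & e (last y s) u.
Proof.
case: (lastP s) => // s' x; rewrite rcons_path last_rcons => /andP[_ e1] _.
exists (last y s'); last by rewrite esym.
by rewrite -rcons_cons mem_rcons inE mem_last orbT.
Qed.

(* Take the rearrangement of [q] whose end has a neighbour closest to the start:
   the cycle that it closes traps the ends of all further rearrangements. *)
Lemma lasso z q V :
    uniq q -> sorted e q -> head z q = z -> 1 < size q ->
    (forall q', perm_eq q' q -> sorted e q' -> head z q' = z ->
     {subset nbs V (last z q') <= q}) ->
  exists y s, [/\ 0 < size s, uniq (y :: s), cycle e (y :: s),
    {subset y :: s <= q} &
    forall s', perm_eq s' s -> path e y s' ->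
     {subset nbs V (last y s') <= y :: s}].
Proof.
move=> uq pq hq q_gt1 Hq.
pose P q' := [&& perm_eq q' q, sorted e q' & head z q' == z].
(* Position of the first neighbour of the end. All rearrangements have the same size, so maximising
   [size q' - fnd q'] minimises it. *)
pose fnd q' := find (e (last z q')) q'.
have /(_ (size q) q)[] := @argmax_uniq T P (fun q' => size q' - fnd q').
- by move=> q' /andP[/perm_uniq ->].
- by move=> q' /andP[/perm_size -> _]; rewrite leq_subr.
- by rewrite /P perm_refl pq hq eqxx.
move=> q1 /and3P[pq1 sq1 /eqP hq1] q1max.
have q1_gt1 : 1 < size q1 by rewrite (perm_size pq1).
have hasq1 : has (e (last z q1)) q1.
  case: (q1) sq1 q1_gt1 => // x s pxs s0.
  by have [u us eu] := has_nbs_last pxs s0; apply/hasP; exists u.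
pose i := fnd q1; pose y := nth z q1 i.
have iq1 : i < size q1 by rewrite /i /fnd -has_find.
have def_q1 : q1 = take i q1 ++ y :: drop i.+1 q1.
  by rewrite -drop_nth // cat_take_drop.
have ey : e (last z q1) y by apply: nth_find.
move: (take _ _) (drop _ _) def_q1 (size_take i q1) => s1 s def_q1.
rewrite iq1 => sz1.
have uq1 : uniq q1 by rewrite (perm_uniq pq1).
have q1_last : last z q1 = last y s by rewrite def_q1 last_cat.
have arr s' : perm_eq s' s -> path e y s' ->
    [/\ perm_eq (s1 ++ y :: s') q, sorted e (s1 ++ y :: s')
      & head z (s1 ++ y :: s') = z].
  move=> ps' pys'; split.
  - by rewrite -(permPr pq1) def_q1 perm_cat2l perm_cons.
  - move: sq1; rewrite {1}def_q1 !sorted_cat_cons => /andP[-> _].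
    by rewrite pys'.
  - by rewrite -[RHS]hq1 def_q1; case: (s1).
exists y, s; split.
- case: s {arr} def_q1 q1_last => // _ q1_last.
  by move: ey; rewrite q1_last eirr.
- by move: uq1; rewrite def_q1 cat_uniq => /and3P[].
- rewrite /= rcons_path -q1_last ey andbT.
  by move: sq1; rewrite def_q1 sorted_cat_cons => /andP[].
- by move=> u us; rewrite -(perm_mem pq1) def_q1 mem_cat us orbT.
move=> s' ps' pys' u uN; have [pq' sq' hq'] := arr s' ps' pys'.
have lastE : last z (s1 ++ y :: s') = last y s' by rewrite last_cat.
have := Hq _ pq' sq' hq' u; rewrite lastE => /(_ uN).
rewrite -(perm_mem pq') mem_cat => /orP[us1|]; last first.
  by rewrite !inE (perm_mem ps').
have : fnd (s1 ++ y :: s') < size s1.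
  rewrite /fnd find_cat lastE.
  have hs1 : has (e (last y s')) s1.
    by apply/hasP; exists u => //; move: uN; rewrite inE => /andP[].
  by rewrite hs1 -has_find.
have /q1max : P (s1 ++ y :: s') by rewrite /P pq' sq' hq' eqxx.
rewrite -[fnd q1]/i !size_cat -sz1 /= (perm_size pq1) -(perm_size pq') size_cat /=.
lia_nat.
Qed.

(* [W] consists of the successors of the neighbours of an end of largest degree:
   these are ends of rotated paths, so their degrees are at most [#|W|]. *)
Lemma rotation_set y s V :
    uniq (y :: s) -> path e y s -> 0 < size s -> {subset y :: s <= V} ->
    (forall s', perm_eq s' s -> path e y s' ->
     {subset nbs V (last y s') <= y :: s}) ->
  exists W : {set T}, [/\ W != set0, #|W| < size (y :: s), W \subset V &
    \sum_(w in W) (#|nbs V w| + #|nbs (V :\: W) w|) <= #|W| * size (y :: s)].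
Proof.
move=> us ps s0 sV Hs.
pose P s' := perm_eq s' s && path e y s'.
have /(_ #|T| s)[] := @argmax_uniq T P (fun s' => #|nbs V (last y s')|).
- by move=> s' /andP[/perm_uniq -> _]; case/andP: us.
- by move=> s' _; apply: max_card.
- by rewrite /P perm_refl.
move=> s1 /andP[ps1 pys1] s1max.
have mem1 : y :: s1 =i y :: s by move=> x; rewrite !inE (perm_mem ps1).
have us1 : uniq (y :: s1).
  by rewrite /= (perm_uniq ps1) (perm_mem ps1).
set v := last y s1 in s1max.
pose W := [set next (y :: s1) u | u in nbs V v].
have cardW : #|W| = #|nbs V v| by rewrite card_imset //; apply: next_inj.
have nbW w : w \in W -> {subset nbs V w <= y :: s} /\ #|nbs V w| <= #|W|.
  case/imsetP=> u uN ->.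
  have uq : u \in y :: s1 by rewrite mem1; apply: Hs uN.
  have evu : e v u by move: uN; rewrite inE => /andP[].
  case: (last_or_next uq) => [uv|[q1 [u' [q2 def_q]]]].
    by move: evu; rewrite uv eirr.
  have -> : next (y :: s1) u = u'.
    by rewrite def_q next_cat_cons // -def_q.
  have lq : last u' q2 = v by rewrite /v -(last_cons y y) def_q last_cat.
  (* The rotation: the edge between [u] and the end [v] allows the tail after [u] to be reversed,
     and [u'] becomes the end. *)
  have sq : sorted e (q1 ++ u :: rev (u' :: q2)).
    have : sorted e (y :: s1) by [].
    rewrite def_q !sorted_cat_cons => /andP[-> /andP[_ pq2]].
    by rewrite path_rotate ?lq.
  have [s' def_s'] : exists s', q1 ++ u :: rev (u' :: q2) = y :: s'.
    by case: (q1) def_q => [|? ?] [-> _]; eexists.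
  have ps' : perm_eq s' s.
    rewrite -(perm_cons y) -def_s' -(permPr (_ : perm_eq (y :: s1) (y :: s))).
      by rewrite def_q perm_cat2l perm_cons perm_rev.
    by rewrite perm_cons.
  have pys' : path e y s' by move: sq; rewrite def_s'.
  have ls' : last y s' = u'.
    by rewrite -(last_cons y) -def_s' last_cat /= rev_cons last_rcons.
  have Ps' : P s' by rewrite /P ps' pys'.
  by rewrite cardW -ls'; split; [apply: Hs | apply: s1max].
(* Only the end [v] has [y] as cyclic successor, and [v] is not its own neighbour; hence [W] misses
   [y]. *)
have Wsub : W \subset [set x in s].
  apply/subsetP=> w /imsetP[u uN ->]; rewrite inE -(perm_mem ps1).
  have : next (y :: s1) u \in y :: s1.
    by rewrite mem_next mem1; apply: Hs uN.
  rewrite inE => /orP[/eqP|//].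
  rewrite -[X in _ = X](next_last us1) => /(next_inj us1) uv.
  by move: uN; rewrite inE uv eirr andbF.
have WV : W \subset V.
  by apply: subset_trans Wsub _; apply/subsetP=> x; rewrite inE => xs; rewrite sV // inE xs orbT.
have s1_gt0 : 0 < size s1 by rewrite (perm_size ps1).
have [u us' evu] := has_nbs_last pys1 s1_gt0.
have W0 : 0 < #|W|.
  rewrite cardW; apply/card_gt0P; exists u.
  by rewrite inE evu sV // -mem1.
exists W; split => //.
- by rewrite -card_gt0.
- apply: leq_ltn_trans (subset_leq_card Wsub) _.
  by rewrite cardsE ltnS card_size.
have Dsize : #|[set x in y :: s]| = size (y :: s).
  by rewrite cardsE; apply/card_uniqP.
have WD : W \subset [set x in y :: s].
  by apply: subset_trans Wsub _; apply/subsetP=> x; rewrite !inE orbC => ->.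
(* The first degree is at most [#|W|] by the choice of [v], the second at most the number of path
   vertices outside [W]. *)
rewrite -sum_nat_const; apply: leq_sum => w /nbW[wD wr].
rewrite -Dsize -(cardsID W [set x in y :: s]) (setIidPr WD) leq_add //.
apply: subset_leq_card; apply/subsetP=> x; rewrite inE => /andP[].
rewrite inE => /andP[xW xV] ewx; rewrite inE xW inE.
by apply: wD; rewrite inE xV.
Qed.

(** The cycle runs from the head to [u], jumps to the last vertex, returns along the path to [u']
    and closes at the head. *)
Lemma crossing_cycle q1 u u' q2 :
    uniq (q1 ++ u :: u' :: q2) -> sorted e (q1 ++ u :: u' :: q2) ->
    2 < size (q1 ++ u :: u' :: q2) ->
    e (head u q1) u' -> e (last u' q2) u ->
  exists2 c, cyc c & perm_eq c (q1 ++ u :: u' :: q2).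
Proof.
move=> uq sq q_gt2 ea eb; exists (q1 ++ u :: rev (u' :: q2)); last first.
  by rewrite perm_cat2l perm_cons perm_rev.
have pq : perm_eq (q1 ++ u :: rev (u' :: q2)) (q1 ++ u :: u' :: q2).
  by rewrite perm_cat2l perm_cons perm_rev.
apply/cycP; rewrite (perm_size pq) (perm_uniq pq); split => //.
have : sorted e (q1 ++ u :: rev (u' :: q2)).
  move: sq; rewrite !sorted_cat_cons => /andP[-> /andP[_ pq2]].
  by rewrite path_rotate.
have lE x : last x (q1 ++ u :: rev (u' :: q2)) = u'.
  by rewrite last_cat /= rev_cons last_rcons.
case: q1 lE ea {uq sq q_gt2 pq} => [|x q1] lE ea /= px.
  by rewrite rcons_path px; move: (lE u) => /= ->; rewrite esym.
by rewrite rcons_path px; move: (lE u) => /= ->; rewrite esym.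
Qed.

(** Ore's argument: by [crossing_cycle] no neighbour of [a] is the successor of a neighbour of the
    last vertex. The two sets are thus disjoint, and neither contains [a]. *)
Lemma ore_path a s : 1 < size s -> uniq (a :: s) -> path e a s ->
    (forall c, cyc c -> ~~ perm_eq c (a :: s)) ->
  #|nbs [set x in a :: s] a| + #|nbs [set x in a :: s] (last a s)|
    < size (a :: s).
Proof.
move=> s_gt1 us ps noc; set b := last a s; set Q := [set x in a :: s].
pose B := [set next (a :: s) u | u in nbs Q b].
have <- : #|B| = #|nbs Q b| by rewrite card_imset //; apply: next_inj.
have Qsize : #|Q| = size (a :: s) by rewrite cardsE; apply/card_uniqP.
have bB : a \notin B.
  apply/imsetP=> -[u uN]; rewrite -{1}(next_last us) => /(next_inj us) ub.
  by move: uN; rewrite inE -ub eirr andbF.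
have aN : a \notin nbs Q a by rewrite inE eirr andbF.
have disj : [disjoint nbs Q a & B].
  rewrite disjoint_subset; apply/subsetP=> x xN; rewrite inE.
  apply/imsetP=> -[u uN def_x]; have ebu : e b u by move: uN; rewrite inE => /andP[].
  have us' : u \in a :: s by move: uN; rewrite !inE => /andP[].
  case: (last_or_next us') => [ub|[q1 [u' [q2 def_q]]]].
    by move: ebu; rewrite ub eirr.
  have xu' : x = u' by rewrite def_x def_q next_cat_cons // -def_q.
  have eax : e a u' by move: xN; rewrite -xu' inE => /andP[].
  have [] := @crossing_cycle q1 u u' q2; rewrite -?def_q //.
  - by case: (q1) def_q => [|? ?] [<- _].
  - by move: ebu; rewrite /b -(last_cons a a) def_q last_cat.
  by move=> c cc; apply/negP/noc.
have : [set a] :|: (nbs Q a :|: B) \subset Q.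
  rewrite !subUset sub1set !inE eqxx /=; apply/andP; split.
    by apply/subsetP=> x; rewrite inE => /andP[].
  apply/subsetP=> x /imsetP[u uN ->]; rewrite inE mem_next.
  by move: uN; rewrite !inE => /andP[].
move/subset_leq_card; rewrite Qsize; apply: leq_trans.
rewrite cardsU1 inE (negPf aN) (negPf bB) add1n ltnS cardsU.
by rewrite (disjoint_setI0 disj) cards0 subn0.
Qed.
End Paths.

(** * Gaps on a longest cycle *)

Section LongestCycle.
Variables (T : finType) (e : rel T).
Hypotheses (esym : symmetric e) (eirr : irreflexive e).
Variables (V : {set T}) (c : seq T).
Hypotheses (cycc : cyc e c) (cV : {subset c <= V}).
Hypothesis cmax : forall c', cyc e c' -> {subset c' <= V} -> size c' <= size c.
Implicit Types (x y z u v w : T) (s t q : seq T).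

Notation C := [set x in c].
Notation nbs := (nbs e).

Let uc : uniq c. Proof. by case/cycP: cycc. Qed.

Lemma rot_cyc x y : x \in c -> y \in c -> x != y -> exists s1 s2,
  [/\ cyc e (x :: s1 ++ y :: s2), perm_eq (x :: s1 ++ y :: s2) c &
      next c =1 next (x :: s1 ++ y :: s2)].
Proof.
move=> xc; case/rot_to: (xc) => i s def_c yc xy.
have ys : y \in s.
  by move: yc; rewrite -(mem_rot i) def_c inE eq_sym (negPf xy).
case/splitPr: ys def_c => s1 s2 def_c; exists s1, s2; rewrite -def_c; split.
- apply/cycP; rewrite size_rot rot_uniq rot_cycle; exact/cycP.
- exact: permEl (perm_rot i c).
- by move=> z; rewrite next_rot.
Qed.

(** Replacing the arc from [x] to [y] by [w :: t] cannot lengthen the cycle, so this arc has more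
    than [size t] inner vertices. *)
Lemma detour x y w t :
    x \in c -> y \in c -> x != y -> uniq (w :: t) -> path e w t ->
    {subset w :: t <= V :\: C} -> e x w -> e (last w t) y ->
  (size t).+3 <= size c /\
  forall j, 0 < j <= (size t).+1 -> iter j (next c) x != y.
Proof.
move=> xc yc xy uwt pwt tR exw ely.
have [s1 [s2 [cyc' pc' next']]] := rot_cyc xc yc xy.
have [sz' u' cy'] := cycP _ _ cyc'.
have tC u : u \in w :: t -> u \notin c.
  by move=> /tR; rewrite !inE => /andP[].
have t_s1 : size t < size s1.
  have /cmax : cyc e (x :: (w :: t) ++ y :: s2).
    apply/cycP; split.
    - by rewrite /= size_cat /=; lia_nat.
    - have u2 : uniq (x :: y :: s2).
        apply: subseq_uniq u'; rewrite -cat1s -[X in subseq _ X]cat1s.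
        by apply: cat_subseq; rewrite ?subseq_refl ?suffix_subseq.
      rewrite (uniq_catCA [:: x] (w :: t)) cat_uniq.
      apply/and3P; split=> //; apply/hasPn=> u us2; apply/negP=> /tC; rewrite -(perm_mem pc').
      move: us2; rewrite !inE mem_cat !inE.
      by case/or3P=> ->; rewrite ?orbT.
    - move: cy'; rewrite /= !rcons_cat !cat_path /= exw pwt ely.
      by case/and3P.
  rewrite (_ : size c = size (x :: s1 ++ y :: s2)); last by rewrite (perm_size pc').
  rewrite /= !size_cat /= => H; suff: (size t).+1 + (size s2).+1 <= size s1 + (size s2).+1 by lia_nat.
  apply: H => u; rewrite inE -cat_cons mem_cat => /orP[/eqP->|/orP[/tR|us2]].
  - exact: cV.
  - by rewrite inE => /andP[].
  - by apply: cV; rewrite -(perm_mem pc') inE mem_cat us2 !orbT.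
split.
  by rewrite -(perm_size pc') /= size_cat /=; lia_nat.
move=> j /andP[j0 jt]; rewrite (eq_iter next') iter_next_nth //; last first.
  by rewrite /= size_cat; lia_nat.
rewrite -cat_cons nth_cat ifT /=; last lia_nat.
have : nth x (x :: s1) j \in x :: s1 by apply: mem_nth => /=; lia_nat.
apply: contraTneq => ->; move: u'; rewrite -cat_cons cat_uniq.
by case/and3P=> _ /hasPn/(_ y (mem_head _ _)).
Qed.

(** Otherwise [w] could be inserted between two consecutive vertices: [detour] for a path of one
    vertex. *)
Lemma attachment_gap w x y : w \in V :\: C -> x \in nbs C w -> y \in nbs C w ->
  next c x != y.
Proof.
move=> wR xN yN; have [xc ewx] : x \in c /\ e w x by move: xN; rewrite !inE => /andP[].
have [yc ewy] : y \in c /\ e w y by move: yN; rewrite !inE => /andP[].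
have [<-|xy] := eqVneq x y.
  have [? _ _] := cycP _ _ cycc; have c1 : 0 < 1 < size c by lia_nat.
  exact: iter_next_neq uc xc c1.
have wwR : {subset [:: w] <= V :\: C} by move=> u; rewrite mem_seq1 => /eqP ->.
have exw : e x w by rewrite esym.
by have [_ /(_ 1 isT)] := @detour x y w [::] xc yc xy isT isT wwR exw ewy.
Qed.

(** From [next c x] along [c] to [y], through [w] to [x], then backwards to [next c y]: this path
    covers [c] and [w]. By maximality its vertices have no Hamiltonian cycle, so [ore_path]
    applies. *)
Lemma next_pair_degree w x y : w \in V :\: C -> x \in nbs C w -> y \in nbs C w ->
  x != y -> #|nbs C (next c x)| + #|nbs C (next c y)| <= size c.
Proof.
move=> wR; rewrite !inE => /andP[xc ewx] /andP[yc ewy] xy.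
have [wC wV] : w \notin c /\ w \in V by move: wR; rewrite !inE => /andP[].
have exw : e x w by rewrite esym. have eyw : e y w by rewrite esym.
have xN : x \in nbs C w by rewrite !inE xc.
have yN : y \in nbs C w by rewrite !inE yc.
have nxy := attachment_gap wR xN yN; have nyx := attachment_gap wR yN xN.
have [s1 [s2 [cyc' pc' next']]] := rot_cyc xc yc xy.
have [sz' u' cy'] := cycP _ _ cyc'.
case: s1 => [|x' s1] in cyc' pc' next' sz' u' cy' *.
  have nx : next c x = y by rewrite next' /= eqxx.
  by rewrite nx eqxx in nxy.
have nx : next c x = x' by rewrite next' /= eqxx.
case: s2 => [|y' s2] in cyc' pc' next' sz' u' cy' *.
  have ny : next c y = x.
    by have := next_last u'; rewrite last_cat /= next'.
  by rewrite ny eqxx in nyx.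
have ny : next c y = y'.
  by rewrite next' (@next_cat_cons _ (x :: x' :: s1)).
rewrite nx ny.
pose q := s1 ++ y :: w :: x :: rev (y' :: s2).
have pq : perm_eq (x' :: q) (w :: c).
  apply/permP=> a; move/permP: pc' => /(_ a).
  rewrite /= !count_cat /= count_rev /=; lia_nat.
have uq : uniq (x' :: q) by rewrite (perm_uniq pq) /= wC.
have pxq : path e x' q.
  move: cy'; rewrite /= rcons_cat cat_path /= => /and3P[_ ps1].
  rewrite rcons_path => /and4P[ey _ ps2 el].
  rewrite /q cat_path ps1 /= ey eyw ewx /=.
  by rewrite -[rev _]/(rev (y' :: s2)) path_rotate.
have lq : last x' q = y' by rewrite /q last_cat /= rev_cons last_rcons.
have sub u : u \in c -> u \in x' :: q by rewrite (perm_mem pq) inE orbC => ->.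
have := ore_path esym eirr _ uq pxq; rewrite lq.
case: ltnP => [_ /(_ isT)|]; last by rewrite /q size_cat /=; lia_nat.
rewrite (perm_size pq) /= ltnS => H.
apply: leq_trans (H _).
  by apply: leq_add; apply: subset_leq_card; apply: nbsS;
     apply/subsetP=> u; rewrite !in_set; apply: sub.
move=> c' cc'; apply/negP=> pc; have := cmax cc'.
rewrite (perm_size pc) (perm_size pq) /= ltnn => F; suff: false by [].
apply: F => u; rewrite (perm_mem pc) (perm_mem pq) inE.
by case/orP=> [/eqP->//|/cV].
Qed.

Lemma double_attachment w : w \in V :\: C -> 2 * #|nbs C w| <= size c.
Proof.
move=> wR; have := @gap_sum _ c (nbs C w) (fun=> 2) uc.
rewrite sum_nat_const mulnC; apply.
  by move=> x; rewrite !inE => /andP[].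
move=> z [|[|j]] // zN _; apply/negP=> yN.
by have := attachment_gap wR zN yN; rewrite eqxx.
Qed.

(* A shortest arc from [A] to [B], starting at [al], has no vertex of [A :|: B]
   inside, so the gap after [al] can be charged the whole path. *)
Lemma linked_attachments w t (A := nbs C w) (B := nbs C (last w t))
    (m := minn (size t) 2) a b :
    uniq (w :: t) -> path e w t -> {subset w :: t <= V :\: C} -> 0 < size t ->
    a \in A -> b \in B -> a != b ->
  2 * #|A :|: B| + m * #|A :&: B| + size t <= size c + m.
Proof.
move=> uwt pwt tR t0 aA bB ab.
have AP x : x \in A -> x \in c /\ e w x by rewrite !inE => /andP[].
have BP x : x \in B -> x \in c /\ e (last w t) x by rewrite !inE => /andP[].
have gapAB x y j : x \in A -> y \in B -> x != y -> 0 < j <= (size t).+1 ->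
    iter j (next c) x != y.
  move=> /AP[xc exw] /BP[yc ey] xy; rewrite esym in exw.
  by have [_] := detour xc yc xy uwt pwt tR exw ey; apply.
have gapBA x y j : x \in B -> y \in A -> x != y -> 0 < j <= (size t).+1 ->
    iter j (next c) x != y.
  move=> /BP[xc ex] /AP[yc ey] xy.
  have [w' [t' [def_t pwt' w'E lE]]] := rev_path_ends esym pwt.
  have szt : size t' = size t.
    by apply: succn_inj; rewrite -[LHS]/(size (w' :: t')) -def_t size_rev.
  have ut' : uniq (w' :: t') by rewrite -def_t rev_uniq.
  have tR' : {subset w' :: t' <= V :\: C} by move=> u; rewrite -def_t mem_rev; apply: tR.
  have exw' : e x w' by rewrite esym w'E.
  have ely' : e (last w' t') y by rewrite lE.
  have [_] := detour xc yc xy ut' pwt' tR' exw' ely'.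
  by rewrite szt; apply.
have tc : (size t).+3 <= size c.
  have [ac exw] := AP _ aA; have [bc ey] := BP _ bB; rewrite esym in exw.
  by have [] := detour ac bc ab uwt pwt tR exw ey.
pose Q k := [exists x in A, exists y in B, (x != y) && (iter k (next c) x == y)].
have Qex : exists k, Q k.
  have [ac _] := AP _ aA; have [bc _] := BP _ bB.
  have [s1 [s2 [cyc' pc' next']]] := rot_cyc ac bc ab.
  have [_ u' _] := cycP _ _ cyc'.
  exists (size s1).+1; apply/existsP; exists a; rewrite aA.
  apply/existsP; exists b; rewrite bB ab (eq_iter next') iter_next_nth //.
    by rewrite /= nth_cat ltnn subnn /= eqxx.
  by rewrite /= size_cat /=; lia_nat.
case: (ex_minnP Qex) => k /existsP[al /andP[alA /existsP[be /andP[beB]]]].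
case/andP=> albe /eqP def_be kmin.
have kt : (size t).+1 < k.
  rewrite ltnNge; apply/negP=> kt; have := gapAB al be k alA beB albe.
  rewrite def_be eqxx kt andbT => H; suff: false by []; apply: H.
  by case: (k) def_be albe => //= ->; rewrite eqxx.
(* An attachment in this range would lie in [A] and be closer to [be], or in [B] and be closer to
   [al], against the minimality of [k]. *)
have alfree j : 0 < j <= (size t).+1 -> iter j (next c) al \notin A :|: B.
  move=> /andP[j0 jt]; rewrite inE negb_or; apply/andP; split; apply/negP => jS.
    have gE : iter (k - j) (next c) (iter j (next c) al) = be.
      by rewrite -iterD subnK //; lia_nat.
    have neq : iter j (next c) al != be by apply: gapAB => //; lia_nat.
    have /kmin : Q (k - j).
      apply/existsP; exists (iter j (next c) al); rewrite jS.
      by apply/existsP; exists be; rewrite beB neq gE eqxx.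
    lia_nat.
  have neq : al != iter j (next c) al.
    have [alc _] := AP _ alA; rewrite eq_sym iter_next_neq //; lia_nat.
  have /kmin : Q j.
    apply/existsP; exists al; rewrite alA.
    by apply/existsP; exists (iter j (next c) al); rewrite jS neq eqxx.
  lia_nat.
(* A common attachment is charged [2 + m]: whichever end the next attachment belongs to, a detour
   can enter at the other end. The charge at [al] exceeds this by at least [size t - m]. *)
pose g0 z := 2 + m * (z \in A :&: B).
pose g z := if z == al then (size t).+2 else g0 z.
have sg : \sum_(z in A :|: B) g z <= size c.
  apply: gap_sum => // [x|z j zZ].
    by rewrite inE => /orP[/AP[]|/BP[]].
  have zc : z \in c by move: zZ; rewrite inE => /orP[/AP[]|/BP[]].
  rewrite /g; have [->|zal] := eqVneq z al; first by move=> ?; apply: alfree; lia_nat.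
  rewrite /g0 => /andP[j0 jg]; apply/negP=> jZ.
  have jt : j <= (size t).+1.
    by move: jg; rewrite /m; case: (_ \in _); lia_nat.
  have neq : z != iter j (next c) z.
    by rewrite eq_sym iter_next_neq //; lia_nat.
  have jB : (iter j (next c) z == iter j (next c) z) = true by apply: eqxx.
  have zA_B : z \in A -> iter j (next c) z \in B -> False.
    move=> zA jB'; have := gapAB _ _ j zA jB' neq.
    by rewrite jB j0 jt => /(_ isT).
  have zB_A : z \in B -> iter j (next c) z \in A -> False.
    move=> zB jA'; have := gapBA _ _ j zB jA' neq.
    by rewrite jB j0 jt => /(_ isT).
  have [zI|zI] := boolP (z \in A :&: B).
    have [zA zB] := setIP zI.
    by move: jZ; rewrite in_setU => /orP[/(zB_A zB)|/(zA_B zA)].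
  have j1 : j = 1 by move: jg; rewrite (negPf zI); lia_nat.
  have wR : w \in V :\: C by apply: tR; rewrite mem_head.
  have lR : last w t \in V :\: C by apply: tR; rewrite mem_last.
  move: jZ zZ; rewrite !in_setU => /orP[jA|jB'] /orP[zA|zB].
  - by have := attachment_gap wR zA jA; rewrite j1 eqxx.
  - exact: zB_A.
  - exact: zA_B.
  - by have := attachment_gap lR zB jB'; rewrite j1 eqxx.
have alZ : al \in A :|: B by rewrite inE alA.
have s0 : \sum_(z in A :|: B) g0 z = 2 * #|A :|: B| + m * #|A :&: B|.
  rewrite big_split /= sum_nat_const mulnC -big_distrr /=; congr (_ + _ * _).
  rewrite -sum1_card big_mkcond [RHS]big_mkcond /=; apply: eq_bigr => z _.
  by rewrite in_setU in_setI; case: (z \in A); case: (z \in B).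
have sgE : \sum_(z in A :|: B | z != al) g z = \sum_(z in A :|: B | z != al) g0 z.
  by apply: eq_bigr => z /andP[_ /negPf zal]; rewrite /g zal.
move: sg s0; rewrite (bigD1 al) //= sgE [X in _ -> X = _ -> _](bigD1 al) //=.
rewrite {1}/g eqxx /g0; case: (al \in _); rewrite ?muln1 ?muln0; lia_nat.
Qed.

End LongestCycle.

(** * Paths outside a longest cycle *)

Section DenseGraph.
Variables (T : finType) (e : rel T).
Hypotheses (esym : symmetric e) (eirr : irreflexive e).
Variables (V : {set T}) (c : seq T).
Hypotheses (cycc : cyc e c) (cV : {subset c <= V}).
Hypothesis cmax : forall c', cyc e c' -> {subset c' <= V} -> size c' <= size c.
Variable N : nat.
Hypotheses (N_gt1 : 1 < N) (hN : #|V| <= 2 * N).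
Hypothesis dense : forall W : {set T}, W \subset V -> W != set0 ->
  2 * #|W| <= #|V| ->
  N * #|W| < \sum_(w in W) (#|nbs e V w| + #|nbs e (V :\: W) w|).
Implicit Types (x y z u v w : T) (s t q : seq T) (W : {set T}).

Notation C := [set x in c].
Notation R := (V :\: C).
Notation nbs := (nbs e).

Let uc : uniq c. Proof. by case/cycP: cycc. Qed.
Let c_gt2 : 2 < size c. Proof. by case/cycP: cycc. Qed.
Let cardC : #|C| = size c. Proof. by rewrite cardsE; apply/card_uniqP. Qed.
Let CV : C \subset V. Proof. by apply/subsetP=> x; rewrite inE; apply: cV. Qed.

Lemma mem_outside x : (x \in R) = (x \in V) && (x \notin c).
Proof. by rewrite !inE andbC. Qed.

Lemma card_outside : #|R| + size c = #|V|.
Proof. by rewrite -cardC -(cardsID C V) (setIidPr CV) addnC. Qed.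

Lemma size_outside q : uniq q -> {subset q <= R} -> size q + size c <= #|V|.
Proof.
move=> uq qR; rewrite -card_outside leq_add2r -(card_uniqP uq).
by apply: subset_leq_card; apply/subsetP.
Qed.

Lemma min_degree v : v \in V -> N < 2 * #|nbs V v|.
Proof.
move=> vV; have cV2 : 2 <= #|V| by rewrite -card_outside; lia_nat.
have := @dense [set v]; rewrite sub1set vV cards1 !muln1 big_set1 => /(_ isT).
have -> : [set v] != set0 by apply/set0Pn; exists v; rewrite set11.
move=> /(_ isT)/(_ cV2) H; apply: leq_trans H _.
by rewrite mul2n -addnn leq_add2l subset_leq_card // nbsS // subsetDl.
Qed.

(** [lasso] and [rotation_set] give a set [W] whose density forces [N < size (y :: s)]. But [y :: s]
    either has two vertices, or is a cycle no longer than [c] sharing at most one vertex with it, so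
    that twice its size is at most [#|V|.+1]. *)
Lemma no_trapped_path z q :
    uniq q -> sorted e q -> head z q = z -> 1 < size q -> {subset q <= V} ->
    #|[set x in q] :&: C| <= 1 ->
    (forall q', perm_eq q' q -> sorted e q' -> head z q' = z ->
     {subset nbs V (last z q') <= q}) ->
  False.
Proof.
move=> uq sq hq q_gt1 qV qC Hq.
have [y [s [s0 us cys ysq Hs]]] := lasso esym eirr uq sq hq q_gt1 Hq.
have ysV : {subset y :: s <= V} by move=> x /ysq/qV.
have pys : path e y s by move: cys; rewrite /= rcons_path => /andP[].
have [W [W0 Ws WV Wsum]] := rotation_set esym eirr us pys s0 ysV Hs.
have Dsize : #|[set x in y :: s]| = size (y :: s).
  by rewrite cardsE; apply/card_uniqP.
have DC : size (y :: s) + size c <= #|V|.+1.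
  rewrite -Dsize -cardC -cardsUI -addn1; apply: leq_add.
    by apply: subset_leq_card; rewrite subUset CV andbT; apply/subsetP=> x; rewrite inE; apply: ysV.
  apply: leq_trans qC; apply: subset_leq_card; apply: setSI.
  by apply/subsetP=> x; rewrite !in_set; apply: ysq.
have W_gt0 : 0 < #|W| by rewrite card_gt0.
have [s_gt1|s_le1] := ltnP 1 (size s).
  have /cmax/(_ ysV) Dc : cyc e (y :: s) by apply/cycP.
  have := dense WV W0; rewrite /= in Ws Wsum DC Dc *.
  move=> /(_ ltac:(lia_nat)) /leq_trans/(_ Wsum).
  by rewrite mulnC ltn_pmul2l //; lia_nat.
have := dense WV W0; rewrite /= in Ws Wsum DC *.
move=> /(_ ltac:(lia_nat)) /leq_trans/(_ Wsum).
by rewrite mulnC ltn_pmul2l //; lia_nat.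
Qed.

(** Here [m = 2], so with attachment sets [A] and [B] the gaps give
    [2 * (#|A| + #|B|) + size t <= size c + 2], while [size t + 1 + size c <= 2 * N]. *)
Lemma no_linked_pair w t a b :
    uniq (w :: t) -> path e w t -> {subset w :: t <= R} -> 1 < size t ->
    a \in nbs C w -> b \in nbs C (last w t) -> a != b ->
    N < #|nbs C w| + #|nbs C (last w t)| + size t ->
  False.
Proof.
move=> uwt pwt tR t1 aA bB ab.
have := linked_attachments esym cycc cV cmax uwt pwt tR (ltnW t1) aA bB ab.
have := size_outside uwt tR; rewrite -cardsUI (minn_idPr t1) /=; lia_nat.
Qed.

(** * A longest path among the vertices outside the cycle *)

Section LongestOutside.
Variables (w0 : T) (t0 : seq T).
Hypotheses (ut0 : uniq (w0 :: t0)) (pt0 : path e w0 t0).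
Hypotheses (t0R : {subset w0 :: t0 <= R}) (t0_gt1 : 1 < size t0).
Hypothesis t0max : forall w t, uniq (w :: t) -> path e w t ->
  {subset w :: t <= R} -> size t <= size t0.

Let arr w t : perm_eq (w :: t) (w0 :: t0) -> 
  [/\ uniq (w :: t), {subset w :: t <= R} & size t = size t0].
Proof.
move=> pt; rewrite (perm_uniq pt); split=> // [x|]; last first.
  by apply: succn_inj; apply: (perm_size pt).
by rewrite (perm_mem pt); apply: t0R.
Qed.

Lemma last_outside w t : perm_eq (w :: t) (w0 :: t0) -> path e w t ->
  {subset nbs R (last w t) <= w0 :: t0}.
Proof.
move=> pt pwt u uN; have [ut tR szt] := arr pt.
have [uR eu] : u \in R /\ e (last w t) u by move: uN; rewrite inE => /andP[].
rewrite -(perm_mem pt); apply/negPn/negP=> ut'.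
have := @t0max w (rcons t u); rewrite size_rcons szt ltnn -rcons_cons.
rewrite rcons_uniq ut' ut rcons_path pwt eu => H.
suff: false by []; apply: H => // x.
by rewrite mem_rcons inE => /orP[/eqP->|/tR].
Qed.

Lemma last_nbs w t : perm_eq (w :: t) (w0 :: t0) -> path e w t ->
  forall u, u \in nbs V (last w t) -> u \notin w0 :: t0 -> u \in nbs C (last w t).
Proof.
move=> pt pwt u; rewrite inE => /andP[uV eu] ut'; rewrite !inE eu andbT.
apply/negPn/negP=> uc'; move/negP: ut'; apply.
by apply: last_outside pt pwt _ _; rewrite inE eu mem_outside uV uc'.
Qed.

Lemma outside_disjoint : [set x in w0 :: t0] :&: C = set0.
Proof.
apply/setP=> x; rewrite in_set0 in_setI [x \in [set x in _ :: _]]inE.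
by apply/negP=> /andP[/t0R]; rewrite mem_outside inE => /andP[_ /negPf->].
Qed.

(** If a rearrangement from [w] ends at a vertex with a neighbour off the path, this neighbour is on
    [c] and differs from one of the attachments of [w]; [no_linked_pair] forbids that. Otherwise the
    path is trapped. *)
Lemma no_heavy_end w t : perm_eq (w :: t) (w0 :: t0) -> path e w t ->
  1 < #|nbs C w| -> N < #|nbs C w| + size t -> False.
Proof.
move=> pt pwt A2 AN; have [ut tR szt] := arr pt.
apply: (@no_trapped_path w (w :: t)) => //.
- by rewrite /= szt; lia_nat.
- by move=> x /tR; rewrite mem_outside => /andP[].
- have -> : [set x in w :: t] = [set x in w0 :: t0].
    by apply/setP=> x; rewrite !in_set (perm_mem pt).
  by rewrite outside_disjoint cards0.
move=> [|w1 t'] pq' sq' /=; first by have := perm_size pq'.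
move=> def_w; rewrite def_w in pq' sq' *.
have pt' := perm_trans pq' pt; have [ut' tR' szt'] := arr pt'.
move=> u uN; rewrite (perm_mem pt); apply/negPn/negP=> uq.
have bB := last_nbs pt' sq' uN uq.
have [a aA ab] : exists2 a, a \in nbs C w & a != u.
  have : 0 < #|nbs C w :\ u|.
    by have := cardsD1 u (nbs C w); case: (u \in _); lia_nat.
  by case/card_gt0P=> a; rewrite in_setD1 => /andP[]; exists a.
by apply: (no_linked_pair ut' sq' tR' _ aA bB ab); lia_nat.
Qed.

(** Any two consecutive vertices of [c'] are the ends of a longest outside path, and averaging the
    density of [c'] finds such a pair with many attachments. *)
Lemma no_closable c' : cyc e c' -> perm_eq c' (w0 :: t0) -> False.
Proof.
move=> cc' pc'; have [c'2 uc' cyc'] := cycP _ _ cc'.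
have szc' : size c' = (size t0).+1 by rewrite (perm_size pc').
have c'R : {subset c' <= R} by move=> x; rewrite (perm_mem pc'); apply: t0R.
have c'c : size c' <= size c.
  by apply: cmax => // x /c'R; rewrite mem_outside => /andP[].
have c'n := size_outside uc' c'R.
have rotP v : v \in c' -> exists t, [/\ perm_eq (next c' v :: t) (w0 :: t0),
    path e (next c' v) t & last (next c' v) t = v].
  move=> vc'; have : next c' v \in c' by rewrite mem_next.
  case/rot_to=> i t def_t; exists t.
  have ut : uniq (next c' v :: t) by rewrite -def_t rot_uniq.
  split.
  - by rewrite -def_t; apply: perm_trans pc'; rewrite perm_rot.
  - have : cycle e (next c' v :: t) by rewrite -def_t rot_cycle.
    by rewrite /= rcons_path => /andP[].
  - apply: (next_inj uc'); rewrite -(next_rot i uc') def_t.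
    exact: next_last ut.
pose W := [set x in c'].
have cardW : #|W| = size c' by rewrite cardsE; apply/card_uniqP.
have WV : W \subset V.
  by apply/subsetP=> x; rewrite inE => /c'R; rewrite mem_outside => /andP[].
have W0 : W != set0 by rewrite -card_gt0 cardW; lia_nat.
have Wsum : \sum_(w in W) (#|nbs V w| + #|nbs (V :\: W) w|)
    <= \sum_(w in W) (#|nbs C w| + #|nbs C (next c' w)|) + #|W| * size t0.
  have -> : \sum_(w in W) (#|nbs C w| + #|nbs C (next c' w)|)
          = \sum_(w in W) (#|nbs C w| + #|nbs C w|).
    rewrite !big_split; congr (_ + _).
    rewrite [RHS](reindex_inj (next_inj uc')) /=.
    by apply: eq_bigl => x; rewrite !inE mem_next.
  rewrite -sum_nat_const -big_split; apply: leq_sum => w wW /=.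
  have wc' : w \in c' by rewrite inE in wW.
  have VW : #|nbs (V :\: W) w| <= #|nbs C w|.
    have [t [pt pwt lt]] := rotP w wc'.
    apply: subset_leq_card; apply/subsetP=> u; rewrite inE in_setD.
    case/andP=> /andP[uW uV] eu; rewrite -lt; apply: (last_nbs pt pwt).
      by rewrite inE uV lt.
    by rewrite -(perm_mem pc'); rewrite inE in uW.
  have WW : #|nbs W w| <= size t0.
    by rewrite -ltnS -szc' -cardW; apply: card_nbs_lt.
  have add3 i j k l : i <= l -> j <= k -> i + j + j <= k + k + l by lia_nat.
  by rewrite (card_nbs_split _ _ WV); apply: add3.
(* Otherwise each pair has at most [N.+1 - size c'] attachments and, as [size t0 = size c' - 1],
   [Wsum] stays below the density bound. *)
have [v vW] : exists2 v, v \in W &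
    N + 2 <= #|nbs C v| + #|nbs C (next c' v)| + size c'.
  apply/exists_inP; rewrite -[X in is_true X]negbK negb_exists_in.
  apply/negP=> /forall_inP H.
  have : \sum_(w in W) (#|nbs C w| + #|nbs C (next c' w)|) <= #|W| * (N.+1 - size c').
    by rewrite -sum_nat_const; apply: leq_sum => w /H; lia_nat.
  have := dense WV W0; rewrite cardW => /(_ ltac:(lia_nat)).
  move: Wsum; rewrite cardW; nia.
have vc' : v \in c' by rewrite inE in vW.
have [t [pt pwt lt]] := rotP v vc'.
have [ut tR szt] := arr pt; move: (next c' v) pt pwt lt ut tR => w pt pwt lt ut tR S.
(* If one end is unattached, the other is heavy. If both have the same single attachment, it closes
   a cycle of [size t0 + 2] vertices; then [c] is at least as long, and [c] and [c'] do not fit into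
   [V]. *)
have [A0|[a aA]] := set_0Vmem (nbs C w).
  have [w' [t' [def_t pwt' w'E lE]]] := rev_path_ends esym pwt.
  have pt' : perm_eq (w' :: t') (w0 :: t0).
    by rewrite -def_t; apply: perm_trans pt; rewrite perm_rev.
  have [_ _ szt'] := arr pt'.
  rewrite A0 cards0 -lt -w'E in S.
  by apply: (no_heavy_end pt' pwt'); lia_nat.
have [B0|[b bB]] := set_0Vmem (nbs C v).
  rewrite B0 cards0 in S.
  by apply: (no_heavy_end pt pwt); lia_nat.
have good x y : x \in nbs C w -> y \in nbs C v -> x != y -> False.
  rewrite -{1}lt => xA yB xy.
  by apply: (no_linked_pair ut pwt tR _ xA yB xy); rewrite ?lt; lia_nat.
have eqxy x y : x \in nbs C w -> y \in nbs C v -> x = y.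
  by move=> xA yB; apply/eqP/negPn/negP=> /(good _ _ xA yB).
have A1 : #|nbs C w| <= 1.
  rewrite -(cards1 b); apply: subset_leq_card; apply/subsetP=> x xA.
  by rewrite inE (eqxy _ _ xA bB).
have B1 : #|nbs C v| <= 1.
  rewrite -(cards1 a); apply: subset_leq_card; apply/subsetP=> x xB.
  by rewrite inE -(eqxy _ _ aA xB).
have [ac ewa] : a \in c /\ e w a by move: aA; rewrite !inE => /andP[].
have eva : e v a.
  by rewrite (eqxy _ _ aA bB); move: bB; rewrite inE => /andP[].
have : cyc e (a :: w :: t).
  apply/cycP; split.
  - by rewrite /= szt; lia_nat.
  - rewrite cons_uniq ut andbT; apply/negP=> /tR; rewrite mem_outside ac.
    by rewrite andbF.
  - by rewrite /= rcons_path pwt lt eva esym ewa.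
move/cmax=> H; have : size (a :: w :: t) <= size c.
  apply: H => x; rewrite inE => /orP[/eqP->|/tR]; first exact: cV.
  by rewrite mem_outside => /andP[].
rewrite /= szt; lia_nat.
Qed.

Lemma no_long_outside_path : False.
Proof.
have [[c' [cc' pc']]|noc] :
    (exists c', cyc e c' /\ perm_eq c' (w0 :: t0)) \/
    (forall c', cyc e c' -> ~~ perm_eq c' (w0 :: t0)).
- case: (boolP [exists c' : (size t0).+1.-tuple T, cyc e c' && perm_eq c' (w0 :: t0)]).
    by case/existsP=> c' /andP[cc' pc']; left; exists c'.
  rewrite negb_exists => /forallP H; right=> c' cc'; apply/negP=> pc'.
  have szc' : size c' == (size t0).+1 by rewrite (perm_size pc').
  by have := H (Tuple szc'); rewrite /= cc' pc'.
- exact: no_closable cc' pc'.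
(* By [ore_path] the two ends have at most [size t] neighbours on the path in total; [min_degree]
   forces the others onto [c]. *)
have heavy w t : perm_eq (w :: t) (w0 :: t0) -> path e w t ->
    N < #|nbs C w| + #|nbs C (last w t)| + size t.
  move=> pt pwt; have [ut tR szt] := arr pt.
  have wV : w \in V by have := tR w; rewrite mem_head mem_outside => /(_ isT)/andP[].
  have lV : last w t \in V.
    by have := tR (last w t); rewrite mem_last mem_outside => /(_ isT)/andP[].
  have noc' c' : cyc e c' -> ~~ perm_eq c' (w :: t).
    by move=> cc'; rewrite (permPr pt); apply: noc.
  have t1 : 1 < size t by rewrite szt.
  have := ore_path esym eirr t1 ut pwt noc'.
  rewrite -[size (w :: t)]/(size t).+1 => ore.
  have Rl : #|nbs R (last w t)| <= #|nbs [set x in w :: t] (last w t)|.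
    apply: subset_leq_card; apply/subsetP=> u uN.
    rewrite inE in_set (perm_mem pt) (last_outside pt pwt uN).
    by move: uN; rewrite inE => /andP[].
  have Rw : #|nbs R w| <= #|nbs [set x in w :: t] w|.
    have [w' [t' [def_t pwt' w'E lE]]] := rev_path_ends esym pwt.
    have pt' : perm_eq (w' :: t') (w0 :: t0).
      by rewrite -def_t; apply: perm_trans pt; rewrite perm_rev.
    apply: subset_leq_card; apply/subsetP=> u uN.
    have := last_outside pt' pwt'; rewrite lE => /(_ _ uN) ut'.
    rewrite inE in_set (perm_mem pt) ut'.
    by move: uN; rewrite inE => /andP[].
  have := min_degree wV; have := min_degree lV.
  rewrite !(card_nbs_split _ _ CV); lia_nat.
(* With [x] put in front, the path meets [c] in the one vertex that [no_trapped_path] allows. An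
   escape after rearrangement is an attachment other than [x], excluded by [heavy] and
   [no_linked_pair]. *)
have unattached w t x : perm_eq (w :: t) (w0 :: t0) -> path e w t ->
    x \in nbs C w -> False.
  move=> pt pwt xA; have [ut tR szt] := arr pt.
  have [xc ewx] : x \in c /\ e w x by move: xA; rewrite !inE => /andP[].
  apply: (@no_trapped_path x (x :: w :: t)) => //.
  - rewrite cons_uniq ut andbT; apply/negP=> /tR; rewrite mem_outside xc.
    by rewrite andbF.
  - by rewrite /= esym ewx.
  - move=> u; rewrite inE => /orP[/eqP->|/tR]; first exact: cV.
    by rewrite mem_outside => /andP[].
  - rewrite -(cards1 x); apply: subset_leq_card; apply/subsetP=> u.
    rewrite in_setI in_set in_cons in_set1 => /andP[/orP[//|/tR]].
    by rewrite mem_outside inE => /andP[_ /negPf->].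
  move=> [|x' q'] pq' sq' /=; first by have := perm_size pq'.
  move=> def_x; rewrite def_x perm_cons in pq' sq' *.
  case: q' => [|w' t'] in pq' sq' *; first by have := perm_size pq'.
  have pt' := perm_trans pq' pt; have [ut' tR' szt'] := arr pt'.
  move: sq' => /= /andP[exw' pwt'] u uN.
  rewrite in_cons (perm_mem pt); apply/norP=> -[ux uq].
  have bB := last_nbs pt' pwt' uN uq.
  have xA' : x \in nbs C w' by rewrite !inE xc esym.
  rewrite eq_sym in ux.
  apply: (no_linked_pair ut' pwt' tR' _ xA' bB ux); first by rewrite szt'.
  exact: heavy.
apply: (@no_trapped_path w0 (w0 :: t0)) => //.
- by rewrite /=; lia_nat.
- by move=> x /t0R; rewrite mem_outside => /andP[].
- by rewrite outside_disjoint cards0.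
move=> [|w1 t'] pq' sq' /=; first by have := perm_size pq'.
move=> def_w u uN; rewrite def_w in pq' sq' uN; apply/negPn/negP=> uq.
have bB := last_nbs pq' sq' uN uq.
have [w' [t'' [def_t pwt' w'E lE]]] := rev_path_ends esym (sq' : path e w0 t').
have pt'' : perm_eq (w' :: t'') (w0 :: t0).
  by rewrite -def_t; apply: perm_trans pq'; rewrite perm_rev.
by apply: (unattached _ _ u pt'' pwt'); rewrite w'E.
Qed.

End LongestOutside.

End DenseGraph.

(** * Arithmetic of the bound *)

(* [D] stands for a sum of degrees, twice the number of edges, and
   [2 * a * (n - a) + a * (d - a) = a * (2 * n + d) - 3 * a * a]. *)
Definition bounded d n D := D <= d * n \/
  exists a, [/\ d < 2 * a, a <= d & D + 3 * a * a <= a * (2 * n + d)].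

Lemma unboundedP d n D : ~ bounded d n D ->
  d * n < D /\ forall a, d < 2 * a -> a <= d -> a * (2 * n + d) < D + 3 * a * a.
Proof.
move=> nb; split; first by rewrite ltnNge; apply/negP=> H; apply: nb; left.
move=> a da ad; rewrite ltnNge; apply/negP=> H.
by apply: nb; right; exists a.
Qed.

(** Let [f a = a * (2 * n + d) - 3 * a * a]. From [f a >= D > f d] a factor [d - a] cancels, leaving
    [2 * n < 3 * a + 2 * d]; combined with [f a > d * n] this gives [2 * d < 3 * a]. *)
Lemma bounded_below_top d n D : bounded d n D -> 0 < d -> d * n < D ->
    2 * d * n < D + 2 * d * d ->
  exists a, [/\ D + 3 * a * a <= a * (2 * n + d), a < d, 2 * d < 3 * a,
               2 * n < 3 * a + 2 * d & d < 2 * a].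
Proof.
case=> [|[a [da ad H]] d0 dn top]; first lia.
have lt_ad : a < d.
  rewrite ltn_neqAle ad andbT; apply/eqP=> E; rewrite E in H; nia.
have n2 : 2 * n < 3 * a + 2 * d by nia.
exists a; split=> //.
have : 2 * a * (3 * a - d) < (3 * a + 2 * d) * (2 * a - d).
  have : n * (2 * a - d) > a * (3 * a - d) by nia.
  nia.
nia.
Qed.

(** The term for [a = d] grows by [2 * d >= x] with each vertex, so [D'] also exceeds it;
    [bounded_below_top] then gives [a < d] and [2 * n < 3 * a + 2 * d]. *)
Lemma size_bound d n D D' x : 0 < d -> 2 * d < n.+1 ->
    ~ bounded d n.+1 D -> bounded d n D' -> D = D' + x -> x <= 2 * d ->
  2 * n + 4 <= 5 * d.
Proof.
move=> d0 dn /unboundedP[_ /(_ d)nb] bD' DE xd.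
have := nb ltac:(lia) (leqnn d) => {}nb.
have [top|top] := ltnP (2 * d * n) (D' + 2 * d * d); last by nia.
have [|low] := ltnP (d * n) D'; last by nia.
by case/(bounded_below_top bD' d0)/(_ top)=> a [H1 H2 H3 H4 H5]; lia.
Qed.

(** If [D'] obeys the term for [a], adding [w] vertices raises this term by [2 * a * w], so [x]
    exceeds that. If [D'] obeys [d * n], [D] is compared with [d * (n + w)] or, beyond [2 * d]
    vertices, with the term for [a = d]. *)
Lemma dense_bound d n w D D' x : 1 < d -> ~ bounded d (n + w) D ->
    bounded d n D' -> D = D' + x -> 0 < w -> w <= n ->
    (2 * d < n + w -> 2 * (n + w) + 2 <= 5 * d) ->
  uphalf (n + w) * w < x.
Proof.
move=> d1 /unboundedP[nb0 nb] bD' DE w0 wn nd.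
have top := nb d ltac:(lia) (leqnn d).
have [low|low] := leqP D' (d * n).
  have [n2d|n2d] := leqP (n + w) (2 * d).
    have : uphalf (n + w) <= d by lia.
    nia.
  have := nd n2d; have : uphalf (n + w) = d + uphalf (n + w - 2 * d) by lia.
  move=> ->; set j := n + w - 2 * d.
  have nwE : n + w = 2 * d + j by lia.
  move=> jd.
  have key : uphalf j * w <= d * j.
    have [i [jE|jE]] : exists i, j = 2 * i \/ j = 2 * i + 1.
      by exists j./2; lia.
    - have -> : uphalf j = i by lia.
      nia.
    have -> : uphalf j = i.+1 by lia.
    have : w <= d + i by lia.
    nia.
  nia.
have [n2d|n2d] := leqP (n + w) (2 * d).
  have hN : uphalf (n + w) <= d by lia.
  case: bD' => [|[a [da ad H]]]; first lia.
  have H2 : 2 * a * w < x by have := nb a da ad; lia.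
  by apply: leq_ltn_trans H2; rewrite leq_mul2r; lia.
have {}nd := nd n2d; have hN : 4 * uphalf (n + w) <= 5 * d by lia.
have [top'|top'] := ltnP (2 * d * n) (D' + 2 * d * d); last by nia.
case: (bounded_below_top bD' (ltnW d1) low top') => a [H1 H2 H3 H4 H5].
have Hx : 2 * a * w < x by have := nb a H5 (ltnW H2); lia.
by apply: leq_ltn_trans Hx; rewrite leq_mul2r; lia.
Qed.

(** The witness is [d * n] for small [s], [a = d] for [c >= 2 * d], and [a = s] when
    [2 * d <= 3 * s]. The remaining case splits at [n = 2 * d], where [d * n] equals the term for
    [a = d]. *)
Lemma final_singletons d n D c s volC : 1 < d -> 
    (2 * d < n -> 2 * n + 2 <= 5 * d) ->
    D <= volC + 2 * s * (n - c) -> volC <= d * c ->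
    (1 < s -> 2 * volC + 2 * d * s <= 2 * d * c + s * c) ->
    2 * s <= c -> c <= n ->
  bounded d n D.
Proof.
move=> d1 nd HD vC1 vC2 sc cn.
have [sd|sd] := leqP (2 * s) d; first by left; nia.
have {}vC2 := vC2 ltac:(lia).
have [c2d|c2d] := leqP (2 * d) c.
  right; exists d; split=> //; first lia.
  have [n2d|n2d] := leqP n (2 * d).
    have E1 : c = n by lia. have E2 : n = 2 * d by lia. subst; nia.
  have {}nd := nd n2d.
  have : D <= d * c + 2 * s * (n - c) by lia.
  have : 2 * s * (n - c) <= maxn c (2 * d) * (n - c) by apply: leq_mul; lia.
  rewrite (maxn_idPl c2d) => H1 H2.
  have : c * (d + (n - c)) + 2 * d * d <= 2 * d * n.
    have [j cE] : exists j, c = 2 * d + j by exists (c - 2 * d); lia.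
    have [i nE] : exists i, n = c + i by exists (n - c); lia.
    subst; nia.
  nia.
have ltsd : s <= d by lia.
have [s3|s3] := leqP (2 * d) (3 * s).
  right; exists s; split=> //.
  have [j cE] : exists j, c = 2 * s + j by exists (c - 2 * s); lia.
  have [i nE] : exists i, n = c + i by exists (n - c); lia.
  subst; nia.
have [i nE] : exists i, n = c + i by exists (n - c); lia.
have [n2d|n2d] := leqP n (2 * d).
  left; subst; nia.
right; exists d; split=> //; first lia.
have [j cE] : exists j, 2 * d = c + j by exists (2 * d - c); lia.
subst; nia.
Qed.

(** An outside vertex may now have an outside neighbour, whence [2 * s + 1]; the stronger
    [3 * s <= c] compensates. *)
Lemma final_edges d n D c s volC : 1 < d -> n <= 2 * d ->
    D <= volC + (2 * s + 1) * (n - c) -> volC <= d * c ->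
    (1 < s -> 2 * volC + 2 * d * s <= 2 * d * c + s * c) ->
    3 * s <= c -> c + 2 <= n ->
  D <= d * n.
Proof.
move=> d1 nd HD vC1 vC2 sc cn.
have [sd|sd] := leqP (2 * s + 1) d; first by nia.
have [u dE] : exists u, d + u = 2 * s + 1 by exists (2 * s + 1 - d); lia.
have u0 : 0 < u by lia.
have {}vC2 := vC2 ltac:(lia).
have [i nE] : exists i, n = c + i by exists (n - c); lia.
have [s3|s3] := leqP (3 * s + 2) (2 * d); first by subst; nia.
have [k nE'] : exists k, n = 3 * s + 2 + k by exists (n - (3 * s + 2)); lia.
have ku : k + 2 * u <= s by lia.
have [j cE] : exists j, c = 3 * s + j by exists (c - 3 * s); lia.
nia.
Qed.

(** The term for [a] bounding [D'] grows by [2 * a], so [a <= s]. By [3 * s + 1 <= n] the term for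
    [s.+1] is at least as large, and it grows by [2 * s + 2]. *)
Lemma edges_large d n D D' s x : 1 < d -> 2 * d < n.+1 -> 
    2 * n + 4 <= 5 * d -> 3 * s + 1 <= n -> ~ bounded d n.+1 D -> 
    bounded d n D' -> D = D' + x -> x <= 2 * s + 2 -> False.
Proof.
move=> d1 dn nd sn /unboundedP[nb0 nb] bD' DE xs.
have top := nb d ltac:(lia) (leqnn d).
have [top'|top'] := ltnP (2 * d * n) (D' + 2 * d * d); last by nia.
have [low|low] := leqP D' (d * n); first by nia.
case: (bounded_below_top bD' (ltnW d1) low top') => a [H1 H2 H3 H4 H5].
have := nb a H5 (ltnW H2); have [as_|as_] := leqP a s; last by nia.
have sd : s < d by lia.
have := nb s.+1 ltac:(lia) sd.
have : a * (2 * n + d) + 3 * s.+1 * s.+1 <= s.+1 * (2 * n + d) + 3 * a * a.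
  have [j sE] : exists j, s = a + j by exists (s - a); lia.
  subst; nia.
nia.
Qed.

(** * Upper bound *)

Section UpperBound.
Variables (T : finType) (e : rel T).
Hypotheses (esym : symmetric e) (eirr : irreflexive e).
Variable d : nat.
Hypothesis d_gt1 : 1 < d.
Hypothesis few : forall c v, cyc e c -> v \in c -> #|nbs e [set x in c] v| <= d.
Implicit Types (x y z u v w : T) (s t q c : seq T) (V W : {set T}).

Notation nbs := (nbs e).
Notation vol := (vol e).

(** [lasso] for a longest path in [V], no rearrangement of which can be extended. *)
Lemma end_cycle V v u : v \in V -> u \in nbs V v -> exists y s,
  [/\ 0 < size s, uniq (y :: s), cycle e (y :: s), {subset y :: s <= V} &
      {subset nbs V (last y s) <= y :: s}].
Proof.
move=> vV uN; have [uV evu] : u \in V /\ e v u by move: uN; rewrite inE => /andP[].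
pose P q := [&& uniq q, sorted e q & all (mem V) q].
have /(_ #|T| [:: v; u])[] := @argmax_uniq T P size.
- by move=> q /and3P[].
- by move=> q /and3P[uq _ _]; rewrite -(card_uniqP uq) max_card.
- by rewrite /P /= mem_seq1 vV uV evu eq_sym (nbs_neq eirr uN).
move=> q /and3P[uq sq /allP qV] qmax.
have q_gt1 : 1 < size q.
  apply: (qmax [:: v; u]).
  by rewrite /P /= mem_seq1 vV uV evu eq_sym (nbs_neq eirr uN).
have hq : head (head v q) q = head v q by case: (q) q_gt1.
have [|y [s [s0 us cs sq' Hs]]] := lasso esym eirr (z := head v q) (V := V) uq sq hq q_gt1.
  move=> q' pq' sq' hq' x xN; rewrite -(perm_mem pq'); apply/negPn/negP=> xq'.
  have [xV ex] : x \in V /\ e (last (head v q) q') x.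
    by move: xN; rewrite inE => /andP[].
  have : P (rcons q' x).
    apply/and3P; split.
    - by rewrite rcons_uniq xq' (perm_uniq pq').
    - by case: q' sq' ex {pq' hq' xq' xN} => //= z q' pq' ez; rewrite rcons_path pq'.
    - apply/allP=> z; rewrite mem_rcons inE => /orP[/eqP->//|].
      by rewrite (perm_mem pq'); apply: qV.
  by move/qmax; rewrite size_rcons (perm_size pq') ltnn.
exists y, s; split=> //; first by move=> x /sq'/qV.
apply: Hs (perm_refl _) _.
by move: cs; rewrite /= rcons_path => /andP[].
Qed.

Lemma low_degree V : V != set0 -> exists2 v, v \in V & #|nbs V v| <= d.
Proof.
case/set0Pn=> v vV; have [vd|] := leqP #|nbs V v| d; first by exists v.
case: (set_0Vmem (nbs V v)) => [->|[u uN] _]; first by rewrite cards0.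
have [y [s [s0 us cs sV Hs]]] := end_cycle vV uN.
exists (last y s); first by apply: sV; apply: mem_last.
have sub : nbs V (last y s) \subset nbs [set x in y :: s] (last y s).
  apply/subsetP=> x xN; rewrite inE in_set Hs //.
  by move: xN; rewrite inE => /andP[].
apply: leq_trans (subset_leq_card sub) _.
have [s1|s1] := leqP (size s) 1; last first.
  by apply: few; [apply/cycP | apply: mem_last].
have : #|nbs [set x in y :: s] (last y s)| < #|[set x in y :: s]|.
  by apply: card_nbs_lt => //; rewrite inE mem_last.
rewrite [X in _ < X]cardsE (card_uniqP us) /=; lia_nat.
Qed.

Lemma vol_complete V : vol V <= #|V| * #|V|.-1.
Proof.
rewrite /vol -sum_nat_const; apply: leq_sum => v vV.
by have := card_nbs_lt eirr vV; case: #|V|.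
Qed.

(** Summed over ordered pairs of distinct elements, each [f x] occurs [2 * #|I|.-1] times, and the
    factor [#|I|.-1] cancels. *)
Lemma pair_sum_bound (I : {set T}) (f : T -> nat) b : 1 < #|I| ->
    (forall x y, x \in I -> y \in I -> x != y -> f x + f y <= b) ->
  2 * \sum_(x in I) f x <= #|I| * b.
Proof.
move=> I1 fb; set S := \sum_(x in I) f x.
have H : \sum_(x in I) \sum_(y in I | y != x) (f x + f y) <= #|I| * (#|I|.-1 * b).
  rewrite -sum_nat_const; apply: leq_sum => x xI.
  have -> : #|I|.-1 = #|[set y in I | y != x]|.
    by rewrite (cardsD1 x I) xI /=; apply: eq_card => y; rewrite !inE andbC.
  rewrite -sum_nat_const big_mkcondr [X in _ <= X]big_mkcond /=.
  rewrite [X in X <= _]big_mkcond; apply: leq_sum => y _; rewrite inE.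
  case yI: (y \in I) => //=; case: ifP => // yx.
  by apply: fb => //; rewrite eq_sym.
have E : \sum_(x in I) \sum_(y in I | y != x) (f x + f y) + 2 * S = #|I| * S + #|I| * S.
  have -> : 2 * S = \sum_(x in I) (f x + f x) by rewrite big_split /= addnn mul2n.
  rewrite -big_split /=.
  have E1 x : x \in I -> \sum_(y in I | y != x) (f x + f y) + (f x + f x)
                        = \sum_(y in I) (f x + f y).
    by move=> xI; rewrite [RHS](bigD1 x) //= addnC.
  rewrite (eq_bigr _ E1) exchange_big /=.
  under eq_bigr do rewrite big_split /= sum_nat_const.
  by rewrite big_split /= sum_nat_const -big_distrr.
have : #|I|.-1 * (2 * S) <= #|I|.-1 * (#|I| * b) by nia.
by rewrite leq_pmul2l //; lia_nat.
Qed.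

(** * Degree sums on a longest cycle *)

Section LongestCycle.
Variables (V : {set T}) (c : seq T).
Hypotheses (cycc : cyc e c) (cV : {subset c <= V}).
Hypothesis cmax : forall c', cyc e c' -> {subset c' <= V} -> size c' <= size c.

Notation C := [set x in c].
Notation R := (V :\: C).

Let uc : uniq c. Proof. by case/cycP: cycc. Qed.
Let cardC : #|C| = size c. Proof. by rewrite cardsE; apply/card_uniqP. Qed.

Lemma vol_cycle : vol C <= d * size c.
Proof.
rewrite mulnC -cardC -sum_nat_const; apply: leq_sum => v; rewrite inE.
exact: few.
Qed.

(** The [s] successors of the neighbours of [w] have average degree at most half of [size c]; the
    other vertices of [c] have degree at most [d]. *)
Lemma vol_cycle_attached w (s := #|nbs C w|) : w \in R -> 1 < s ->
  2 * vol C + 2 * d * s <= 2 * d * size c + s * size c.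
Proof.
move=> wR s1; pose I := [set next c x | x in nbs C w].
have cardI : #|I| = s by rewrite card_imset //; apply: next_inj.
have IC : I \subset C.
  apply/subsetP=> x /imsetP[y yN ->]; rewrite inE mem_next.
  by move: yN; rewrite !inE => /andP[].
have HI : 2 * \sum_(x in I) #|nbs C x| <= #|I| * size c.
  apply: pair_sum_bound; first by rewrite cardI.
  move=> _ _ /imsetP[x xN ->] /imsetP[y yN ->] neq.
  apply: (next_pair_degree esym eirr cycc cV cmax wR xN yN).
  by apply: contraNneq neq => ->.
have HC : \sum_(x in C :\: I) #|nbs C x| <= (size c - s) * d.
  rewrite -cardI -cardC -(setIidPr IC) -cardsD -sum_nat_const (setIidPr IC).
  by apply: leq_sum => x; rewrite !inE => /andP[_ xc]; apply: few.
have sc : s <= size c by rewrite -cardI -cardC subset_leq_card.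
rewrite /vol (big_setID I) /= (setIidPr IC); rewrite cardI in HI; move: HI HC.
move: (\sum_(i in I) _) (\sum_(i in C :\: I) _) => a b.
nat_hyps; nia.
Qed.

End LongestCycle.

Lemma bounded_vol V : bounded d #|V| (vol V).
Proof.
have [n] := ubnP #|V|; elim: n V => // n IH V Vn.
have [//|nb] : bounded d #|V| (vol V) \/ ~ bounded d #|V| (vol V).
  have [le|lt] := leqP (vol V) (d * #|V|); first by left; left.
  case: (boolP [exists a : 'I_d.+1, (d < 2 * a) && (vol V + 3 * a * a <= a * (2 * #|V| + d))]).
    case/existsP=> a /andP[da H]; left; right; exists (a : nat); split=> //.
    by rewrite -ltnS.
  rewrite negb_exists => /forallP H; right; case=> [|[a [da ad Ha]]].
    by rewrite leqNgt lt.
  by have := H (Ordinal (ad : a < d.+1)); rewrite /= da Ha.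
have [nb0 nb1] := unboundedP nb.
have Vd : d + 2 <= #|V|.
  by have := vol_complete V; nat_hyps; nia.
have IHW W : W \subset V -> W != set0 -> bounded d #|V :\: W| (vol (V :\: W)).
  move=> WV W0; apply: IH; apply: leq_trans (_ : #|V| <= n); last by [].
  by rewrite -(cardsID W V) (setIidPr WV) -[X in X < _]add0n ltn_add2r card_gt0.
have degx v : v \in V -> bounded d #|V|.-1 (vol (V :\ v)) /\ exists2 x,
    vol V = vol (V :\ v) + x & x <= 2 * #|nbs V v|.
  move=> vV; have vs : [set v] \subset V by rewrite sub1set.
  split.
    have := IHW _ vs; rewrite -card_gt0 cards1 => /(_ isT).
    by rewrite (cardsD1 v V) vV.
  eexists; first exact: vol_split vs.
  by rewrite big_set1 mul2n -addnn leq_add2l subset_leq_card // nbsS // subsetDl.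
(* Induction applies after deleting a vertex of degree at most [d]. *)
have nd : 2 * d < #|V| -> 2 * #|V| + 2 <= 5 * d.
  move=> n2d; have [v vV vd] : exists2 v, v \in V & #|nbs V v| <= d.
    by apply: low_degree; rewrite -card_gt0; lia_nat.
  have [bv [x xE xd]] := degx v vV.
  have nE : #|V| = #|V|.-1.+1 by lia_nat.
  rewrite nE in nb n2d *.
  by have := size_bound (ltnW d_gt1) n2d nb bv xE (leq_trans xd _); lia_nat.
pose N := uphalf #|V|.
have hN : #|V| <= 2 * N by rewrite /N; lia_nat.
have N1 : 1 < N by rewrite /N; lia_nat.
have dense W : W \subset V -> W != set0 -> 2 * #|W| <= #|V| ->
    N * #|W| < \sum_(w in W) (#|nbs V w| + #|nbs (V :\: W) w|).
  move=> WV W0 W2.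
  have nE : #|V :\: W| + #|W| = #|V| by rewrite -(cardsID W V) (setIidPr WV) addnC.
  rewrite /N -nE in nb nd W2 *.
  apply: (dense_bound d_gt1 nb (IHW W WV W0) (vol_split esym WV)) => //.
    by rewrite card_gt0.
  by lia_nat.
have mindeg v : v \in V -> N < 2 * #|nbs V v|.
  move=> vV; have := dense [set v]; rewrite sub1set vV -card_gt0 cards1 !muln1 big_set1.
  move=> /(_ isT isT) H; apply: leq_trans (H _) _; first by lia_nat.
  by rewrite mul2n -addnn leq_add2l subset_leq_card // nbsS // subsetDl.
have [v0 v0V] : exists v, v \in V by apply/set0Pn; rewrite -card_gt0; lia_nat.
have [c0 cycc0 c0V] : exists2 c, cyc e c & {subset c <= V}.
  have [u uN] : exists u, u \in nbs V v0.
    by apply/set0Pn; rewrite -card_gt0; have := mindeg _ v0V; lia_nat.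
  have [y [s [s0 us cs sV Hs]]] := end_cycle v0V uN.
  exists (y :: s) => //; apply/cycP; split=> //.
  have lV : last y s \in V by apply: sV; apply: mem_last.
  have := mindeg _ lV; have : #|nbs V (last y s)| < size (y :: s).
    rewrite -(card_uniqP us) [X in _ < X](cardD1 (last y s)) mem_last ltnS.
    apply: subset_leq_card; apply/subsetP=> x xN; rewrite !inE -in_cons.
    by rewrite (nbs_neq eirr xN) Hs.
  by rewrite /=; lia_nat.
pose P c := cyc e c && all (mem V) c.
have /(_ #|T| c0)[] := @argmax_uniq T P size.
- by move=> c /andP[/cycP[]].
- by move=> c /andP[/cycP[_ uc _] _]; rewrite -(card_uniqP uc) max_card.
- by rewrite /P cycc0; apply/allP.
move=> c /andP[cycc /allP cV] cmax'.
have cmax c' : cyc e c' -> {subset c' <= V} -> size c' <= size c.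
  by move=> cc' c'V; apply: cmax'; rewrite /P cc'; apply/allP.
pose C := [set x in c]; pose R := V :\: C.
have CV : C \subset V by apply/subsetP=> x; rewrite inE; apply: cV.
have cardR : #|R| + size c = #|V|.
  by rewrite (card_outside cycc cV).
have short w t : uniq (w :: t) -> path e w t -> {subset w :: t <= R} -> size t <= 1.
  move=> uwt pwt tR; rewrite leqNgt; apply/negP=> t1.
  pose Q q := [&& uniq q, sorted e q & all (mem R) q].
  have Qwt : Q (w :: t) by apply/and3P; split=> //; apply/allP.
  have /(_ #|T| (w :: t))[] := @argmax_uniq T Q size.
  - by move=> q /and3P[].
  - by move=> q /and3P[uq _ _]; rewrite -(card_uniqP uq) max_card.
  - exact: Qwt.
  move=> [|w0 t0] /and3P[u0 p0 /allP q0R] qmax; first by have := qmax _ Qwt.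
  have t0_gt1 : 1 < size t0 by have := qmax _ Qwt; rewrite /=; lia_nat.
  apply: (no_long_outside_path esym eirr cycc cV cmax N1 hN dense u0 p0 q0R t0_gt1).
  move=> w1 t1' u1 p1 q1; have : Q (w1 :: t1') by apply/and3P; split=> //; apply/allP.
  by move/qmax.
have degR w : w \in R -> #|nbs R w| <= 1.
  move=> wR; rewrite leqNgt; apply/negP=> /card_gt1P[x [y [xN yN xy]]].
  have [[xR ewx] [yR ewy]] : (x \in R /\ e w x) /\ (y \in R /\ e w y).
    by move: xN yN; rewrite inE => /andP[-> ->]; rewrite inE => /andP[-> ->].
  have : size [:: w; y] <= 1; last by [].
  apply: (short x).
  - rewrite /= !inE negb_or xy (nbs_neq eirr xN) /= eq_sym.
    by rewrite (nbs_neq eirr yN).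
  - by rewrite /= esym ewx ewy.
  - by apply/(@allP _ (mem R)); rewrite /= xR wR yR.
have volE : vol V = vol C + \sum_(w in R) (2 * #|nbs C w| + #|nbs R w|).
  have RV : R \subset V by apply: subsetDl.
  have VR : V :\: R = C by rewrite setDDr setDv set0U (setIidPr CV).
  rewrite (vol_split esym RV) VR; congr (_ + _); apply: eq_bigr => w _.
  by rewrite (card_nbs_split e w CV) mul2n -addnn addnAC.
have cn : size c <= #|V| by lia_nat.
have RE : #|V| - size c = #|R| by lia_nat.
pose s := \max_(w in R) #|nbs C w|.
have sP w : w \in R -> #|nbs C w| <= s by move=> wR; apply: leq_bigmax_cond.
have vC1 := vol_cycle cycc.
have [R0|[w1 w1R]] := set_0Vmem R.
  have s0 : s = 0 by rewrite /s R0 big_set0.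
  apply: (@final_singletons d #|V| (vol V) (size c) 0 (vol C)) => //.
  by rewrite volE R0 big_set0 leq_add2l.
have [w wR sw] : exists2 w, w \in R & s = #|nbs C w|.
  have : 0 < #|R| by rewrite card_gt0; apply/set0Pn; exists w1.
  by case/(eq_bigmax_cond (fun w => #|nbs C w|))=> w wR sE; exists w.
have vC2 : 1 < s -> 2 * vol C + 2 * d * s <= 2 * d * size c + s * size c.
  by rewrite sw; apply: (vol_cycle_attached cycc cV cmax wR).
have sc : 2 * s <= size c by rewrite sw (double_attachment esym cycc cV cmax wR).
(* The split is whether some outside edge has [s] attachments at both ends. *)
have [/exists_inP[x xR /exists_inP[y yR /and3P[exy /eqP sx /eqP sy]]]|single] :=
  boolP [exists x in R, exists y in R, [&& e x y, #|nbs C x| == s & #|nbs C y| == s]].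
  have R2 : 1 < #|R|.
    by apply/card_gt1P; exists x, y; split=> //; apply: contraTneq exy => ->; rewrite eirr.
  (* For an edge [m = 1], so the gaps give [4 * s - #|nbs C x :&: nbs C y| <= size c], and the
     intersection has at most [s] vertices. *)
  have s3 : 3 * s <= size c.
    have [c3 _ _] := cycP _ _ cycc.
    have [s1|s1] := leqP s 1; first by lia_nat.
    have xyR : {subset [:: x; y] <= V :\: C}.
      by apply/(@allP _ (mem R)); rewrite /= xR yR.
    have uxy : uniq [:: x; y].
      by rewrite /= mem_seq1 andbT; apply: contraTneq exy => ->; rewrite eirr.
    have [a aA] : exists a, a \in nbs C x by apply/set0Pn; rewrite -card_gt0 sx; lia_nat.
    have [b bB ab] : exists2 b, b \in nbs C y & a != b.
      have : 0 < #|nbs C y :\ a| by have := cardsD1 a (nbs C y); rewrite sy; case: (a \in _); lia_nat.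
      by case/card_gt0P=> b; rewrite in_setD1 eq_sym => /andP[ab bB]; exists b.
    have pxy : path e x [:: y] by rewrite /= exy.
    have := linked_attachments esym cycc cV cmax uxy pxy xyR isT aA bB ab.
    have := cardsUI (nbs C x) (nbs C y).
    have : #|nbs C x :&: nbs C y| <= #|nbs C x| by apply: subset_leq_card; apply: subsetIl.
    rewrite /= sx sy; move: #|_ :&: _| #|_ :|: _| => i j; lia_nat.
  have degx' : #|nbs V x| <= s + 1.
    by rewrite (card_nbs_split e x CV) sx leq_add2l degR.
  have [n2d|n2d] := leqP #|V| (2 * d).
    left; apply: (@final_edges d #|V| (vol V) (size c) s (vol C)) => //; last by lia_nat.
    rewrite volE leq_add2l mulnC RE -sum_nat_const; apply: leq_sum => u uR.
    by have := sP u uR; have := degR u uR; lia_nat.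
  exfalso; have [bx [z zE zd]] := degx x (subsetP (subsetDl _ _) _ xR).
  have nE : #|V| = #|V|.-1.+1 by lia_nat.
  have nd' := nd n2d; rewrite nE in nb n2d nd' cardR.
  by apply: (@edges_large d #|V|.-1 _ _ s z d_gt1 n2d _ _ nb bx zE); lia_nat.
apply: (@final_singletons d #|V| (vol V) (size c) s (vol C)) => //.
(* Every outside edge has an end with positive deficit [f], and outside edges are disjoint; so the
   deficits pay for them and outside vertices contribute [2 * s] on average at most. *)
pose f w := s - #|nbs C w|.
have pairs : \sum_(u in R) #|nbs R u| <= \sum_(u in R) 2 * f u.
  have half : \sum_(u in R) \sum_(v in R) e u v * f u <= \sum_(u in R) f u.
    apply: leq_sum => u uR; rewrite -big_distrl /= -card_nbs_sum.
    by have := degR u uR; case: #|nbs R u| => [|[|?]] // _; rewrite mul1n.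
  have half' : \sum_(u in R) \sum_(v in R) e u v * f v <= \sum_(u in R) f u.
    rewrite exchange_big /=; apply: leq_trans half; apply: leq_sum => u uR.
    by apply: leq_sum => v vR; rewrite esym.
  rewrite -big_distrr /= mul2n -addnn; apply: leq_trans (leq_add half half').
  rewrite -big_split; apply: leq_sum => u uR; rewrite -big_split card_nbs_sum /=.
  apply: leq_sum => v vR; rewrite -mulnDr; case euv: (e u v) => //; rewrite mul1n.
  move: single; rewrite negb_exists_in => /forall_inP/(_ u uR).
  rewrite negb_exists_in => /forall_inP/(_ v vR); rewrite euv /= negb_and.
  by have := sP u uR; have := sP v vR; rewrite /f; lia_nat.
rewrite volE leq_add2l RE [X in _ <= X]mulnC -sum_nat_const big_split /=.
apply: leq_trans (leq_add (leqnn _) pairs) _; rewrite -big_split /=.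
by apply: leq_sum => u uR; have := sP u uR; rewrite /f; lia_nat.
Qed.

End UpperBound.

(** * Edge sets and lower bound *)

Section EdgeSets.
Variable T : finType.
Implicit Types (E F : {set {set T}}) (A : {set T}) (u v w x y : T) (a : {set T}).

Definition deg E v := #|[set a in E | v \in a]|.

Lemma adj_sym E : symmetric (adj E).
Proof. by move=> x y; rewrite /adj setUC. Qed.

Lemma simpleP E : reflect (forall a, a \in E -> #|a| = 2) (simple_graph E).
Proof. by apply: (iffP forall_inP) => H a /H; [move/eqP | move=> ->]. Qed.

Lemma adj_irr E : simple_graph E -> irreflexive (adj E).
Proof.
move=> /simpleP sE x; apply/negP=> /sE.
by rewrite setUid cards1.
Qed.

Lemma edge_at a v : #|a| = 2 -> v \in a -> exists2 u, u != v & a = [set v; u].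
Proof.
move=> /eqP/cards2P[x [y [xy ->]]]; rewrite !inE => /orP[]/eqP->.
  by exists y; rewrite // eq_sym.
by exists x; rewrite // setUC.
Qed.

Lemma set2_injr v u u' : [set v; u] = [set v; u'] -> u != v -> u = u'.
Proof.
move=> E uv; have : u \in [set v; u'] by rewrite -E !inE eqxx orbT.
by rewrite !inE (negPf uv) => /eqP.
Qed.

Lemma deg_nbs E A v : simple_graph E -> (forall a, a \in E -> a \subset A) ->
  deg E v = #|nbs (adj E) A v|.
Proof.
move=> sE EA; rewrite /deg.
have -> : [set a in E | v \in a] = [set [set v; u] | u in nbs (adj E) A v].
  apply/setP=> a; rewrite inE; apply/andP/imsetP => [[aE va]|[u uN ->]].
    have [u uv def_a] := edge_at (simpleP _ sE _ aE) va; exists u => //.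
    rewrite inE /adj -def_a aE andbT; apply: (subsetP (EA _ aE)).
    by rewrite def_a !inE eqxx orbT.
  by move: uN; rewrite inE => /andP[_ ?]; rewrite !inE eqxx.
rewrite card_in_imset // => u u' uN _ /= /set2_injr; apply.
exact: (nbs_neq (adj_irr sE) uN).
Qed.

Lemma sum_deg E A : simple_graph E -> (forall a, a \in E -> a \subset A) ->
  \sum_(v in A) deg E v = 2 * #|E|.
Proof.
move=> sE EA.
have degE v : deg E v = \sum_(a in E) (v \in a).
  rewrite /deg -sum1dep_card big_mkcondr; apply: eq_bigr => a _.
  by case: (v \in a).
under eq_bigr do rewrite degE.
rewrite exchange_big mulnC -sum_nat_const; apply: eq_bigr => a aE /=.
rewrite -(simpleP _ sE _ aE) -sum1_card [RHS](big_setID A) /=.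
rewrite [X in _ = _ + X]big1 ?addn0 => [|v]; last first.
  by rewrite inE => /andP[vA /(subsetP (EA _ aE))]; rewrite (negPf vA).
rewrite (setIidPl (EA _ aE)) big_mkcond [RHS]big_mkcond; apply: eq_bigr => v _.
have := subsetP (EA _ aE) v.
by case: (v \in a) => [->|_] //; case: ifP.
Qed.

Lemma deg_setU1 a E v : deg (a |: E) v <= (v \in a) + deg E v.
Proof.
rewrite /deg; have -> : [set b in a |: E | v \in b]
    = [set b in [set a] | v \in b] :|: [set b in E | v \in b].
  by apply/setP=> b; rewrite !inE andb_orl.
rewrite cardsU; apply: leq_trans (leq_subr _ _) _; rewrite leq_add2r.
 case va: (v \in a).
  rewrite /= -(cards1 a); apply: subset_leq_card; apply/subsetP=> b.
  by rewrite !inE => /andP[].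
rewrite leqn0 cards_eq0; apply/eqP/setP=> b; rewrite !inE.
by case: eqP => // ->; rewrite va.
Qed.

Lemma deg_setD1 a E v : a \in E -> (v \in a) + deg (E :\ a) v = deg E v.
Proof.
move=> aE; rewrite /deg (cardsD1 a [set b in E | v \in b]) !inE aE /=.
by congr (_ + _); apply: eq_card => b; rewrite !inE andbA.
Qed.

(* In a graph with the most edges among those of maximum degree at most [r],
   a missing degree of two would allow to switch edges around and add one. *)
Lemma near_regular A r : r < #|A| -> exists E, [/\ simple_graph E,
  forall a, a \in E -> a \subset A, forall v, deg E v <= r &
  r * #|A| <= 2 * #|E| + 1].
Proof.
move=> rA.
pose P E := [&& simple_graph E, [forall a in E, a \subset A] & [forall v, deg E v <= r]].
have P0 : P set0.
  apply/and3P; split.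
  - by apply/simpleP=> a; rewrite inE.
  - by apply/forall_inP=> a; rewrite inE.
  - apply/forallP=> v; rewrite /deg (_ : [set _ in _ | _] = set0) ?cards0 //.
    by apply/setP=> a; rewrite !inE.
have [E /and3P[sE EA' degr'] Emax] : exists2 E : {set {set T}}, P E &
    forall F : {set {set T}}, P F -> #|F| <= #|E|.
  by case: (arg_maxnP (fun E => #|E|) P0) => E PE Emax; exists E.
have EA a : a \in E -> a \subset A by apply: (forall_inP EA').
have degr v : deg E v <= r by apply: (forallP degr').
exists E; split=> //; rewrite leqNgt; apply/negP=> few.
have sdeg := sum_deg sE EA.
have degE v := deg_nbs v sE EA.
have eirr := adj_irr sE; have esym := adj_sym E.
have addE u v : u \in A -> v \in A -> u != v -> deg E u < r -> deg E v < r ->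
    adj E u v.
  move=> uA vA uv du dv; apply/negPn/negP=> nuv.
  have : P ([set u; v] |: E).
    apply/and3P; split.
    - apply/simpleP=> a; rewrite in_setU1 => /orP[/eqP->|/(simpleP _ sE)//].
      by rewrite cards2 uv.
    - apply/forall_inP=> a; rewrite in_setU1 => /orP[/eqP->|/EA//].
      by rewrite subUset !sub1set uA.
    - apply/forallP=> w; apply: leq_trans (deg_setU1 _ _ _) _.
      rewrite !inE; have := degr w; case: eqP => [->|_]; first by lia_nat.
      by case: eqP => [->|_]; lia_nat.
  by move/Emax; rewrite cardsU1 (nuv : [set u; v] \notin E) /= add1n ltnn.
(* The total missing degree is at least two: either two vertices miss one each, or [u = v] misses
   two. *)
have [u [v [uA vA du dv duv]]] : exists u v,
    [/\ u \in A, v \in A, deg E u < r, deg E v < r & u = v -> (deg E u).+1 < r].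
  have [u uA du] : exists2 u, u \in A & deg E u < r.
    apply/exists_inP; rewrite -[X in is_true X]negbK negb_exists_in.
    apply/negP=> /forall_inP H; have : #|A| * r <= \sum_(v in A) deg E v.
      by rewrite -sum_nat_const; apply: leq_sum => v /H; rewrite -leqNgt.
    by rewrite sdeg mulnC; lia_nat.
  have [du2|du2] := ltnP (deg E u).+1 r; first by exists u, u.
  have [v vAu dv] : exists2 v, v \in A :\ u & deg E v < r.
    apply/exists_inP; rewrite -[X in is_true X]negbK negb_exists_in.
    apply/negP=> /forall_inP H.
    have : #|A :\ u| * r <= \sum_(v in A :\ u) deg E v.
      by rewrite -sum_nat_const; apply: leq_sum => v /H; rewrite -leqNgt.
    have {}sdeg : deg E u + \sum_(v in A :\ u) deg E v = 2 * #|E|.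
      by rewrite -sdeg (big_setD1 u uA).
    have := cardsD1 u A; rewrite uA /= add1n => cA.
    by rewrite cA mulnS mulnC in few; lia_nat.
  exists u, v; split=> // [|uv]; first by move: vAu; rewrite inE => /andP[].
  by move: vAu; rewrite uv !inE eqxx.
have uv_near : u \in v |: nbs (adj E) A v.
  have [->|uv] := eqVneq u v; first by rewrite setU11.
  by rewrite in_setU1 inE uA esym addE ?orbT.
have nearC w : deg E w < r -> #|w |: nbs (adj E) A w| <= r.
  by move=> dw; rewrite cardsU1 inE eirr andbF add1n -degE.
have [x xA /norP[xu nux]] : exists2 x, x \in A & ~~ ((x == u) || adj E u x).
  have : ~~ (A \subset u |: nbs (adj E) A u).
    apply/negP=> /subset_leq_card; have := nearC _ du; lia_nat.
  case/subsetPn=> x xA; rewrite in_setU1 inE xA; by exists x.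
have dx : deg E x = r.
  apply/eqP; rewrite eqn_leq degr leqNgt; apply/negP=> dx.
  by move: nux; rewrite addE // eq_sym.
(* The set [v |: nbs (adj E) A v] has at most [r] elements and contains [u], which is not among the
   [r] neighbours of [x]. *)
have [y yx ynv] : exists2 y, y \in nbs (adj E) A x & y \notin v |: nbs (adj E) A v.
  apply/subsetPn/negP=> sub.
  have /eqP eqN : nbs (adj E) A x == v |: nbs (adj E) A v.
    by rewrite eqEcard sub -degE dx nearC.
  by move: uv_near; rewrite -eqN inE esym (negPf nux) andbF.
have [yA exy] : y \in A /\ adj E x y by move: yx; rewrite inE => /andP[].
have yv : y != v by move: ynv; rewrite in_setU1 => /norP[].
have nvy : ~~ adj E v y by move: ynv; rewrite in_setU1 inE yA => /norP[].
have yu : y != u by apply: contraNneq ynv => ->.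
have xv : x != v.
  apply/eqP=> xv; move: uv_near; rewrite -xv in_setU1 eq_sym (negPf xu) inE esym.
  by rewrite (negPf nux) andbF.
have xy : x != y by apply: contraTneq exy => ->; rewrite eirr.
(* The switch: the edge [xy] is replaced by [vy] and [ux], so only [u] and [v] gain degree. *)
pose E1 := E :\ [set x; y]; pose E2 := [set v; y] |: E1.
have nvy1 : [set v; y] \notin E1 by rewrite in_setD1 negb_and nvy orbT.
have nux2 : [set u; x] \notin E2.
  rewrite in_setU1 in_setD1 negb_or negb_and nux orbT andbT.
  apply/eqP=> H; have : x \in [set v; y] by rewrite -H !inE eqxx orbT.
  by rewrite !inE (negPf xv) (negPf xy).
have : P ([set u; x] |: E2).
  apply/and3P; split.
  - apply/simpleP=> a; rewrite in_setU1 in_setU1 in_setD1.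
    case/or3P=> [/eqP->|/eqP->|/andP[_ /(simpleP _ sE)//]].
      by rewrite cards2 eq_sym xu.
    by rewrite cards2 eq_sym yv.
  - apply/forall_inP=> a; rewrite in_setU1 in_setU1 in_setD1.
    case/or3P=> [/eqP->|/eqP->|/andP[_ /EA//]].
      by rewrite subUset !sub1set uA.
    by rewrite subUset !sub1set vA.
  - apply/forallP=> w; apply: leq_trans (deg_setU1 _ _ _) _.
    apply: leq_trans (leq_add (leqnn _) (deg_setU1 _ _ _)) _.
    have := deg_setD1 w (exy : [set x; y] \in E); have := degr w.
    rewrite -/E1 !inE.
    have [->|wx] := eqVneq w x; first by rewrite (negPf xu) (negPf xv) (negPf xy) /=; lia_nat.
    have [->|wy] := eqVneq w y; first by rewrite (negPf yu) /=; lia_nat.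
    rewrite !orbF add0n.
    have [->|wu] := eqVneq w u; last by have [->|wv] := eqVneq w v; lia_nat.
    by have [uv|uv] := eqVneq u v; [have := duv uv | ]; lia_nat.
have cE : #|E| = #|E1|.+1.
  by rewrite (cardsD1 [set x; y] E) (exy : [set x; y] \in E) add1n.
by move/Emax; rewrite cardsU1 nux2 cardsU1 nvy1 cE /= !add1n ltnn.
Qed.

(** The 2 counts [prev c v] and [next c v], distinct because a cycle has at least three vertices. *)
Lemma chords_at_nbs E c v : simple_graph E -> is_cycle E c -> v \in c ->
  #|chords_at E c v| + 2 = #|nbs (adj E) [set x in c] v|.
Proof.
move=> sE cc vc; have eirr := adj_irr sE.
have [c3 uc cyc_c] := cycP _ _ (cc : cyc (adj E) c).
set C := [set x in c]; set Nv := nbs _ _ _.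
have nN : next c v \in Nv by rewrite !inE mem_next vc next_cycle.
have pN : prev c v \in Nv.
  by rewrite !inE mem_prev vc adj_sym prev_cycle.
have pn : prev c v != next c v.
  have : iter 2 (next c) v != v by apply: iter_next_neq.
  by apply: contraNneq => /= <-; rewrite next_prev.
have -> : chords_at E c v = [set [set v; u] | u in Nv :\ next c v :\ prev c v].
  apply/setP=> a; apply/idP/imsetP => [|[u uN ->]].
    rewrite !inE => /andP[/and3P[aE ac anc] va].
    have [u uv def_a] := edge_at (simpleP _ sE _ aE) va; exists u => //.
    rewrite !inE /adj -def_a aE.
    have -> : u \in c by apply: (subsetP ac); rewrite def_a !inE eqxx orbT.
    rewrite !andbT; apply/andP; split; apply: contraNneq anc => uE.
      apply/imsetP; exists (prev c v); first by rewrite mem_prev.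
      by rewrite next_prev // def_a uE setUC.
    by apply/imsetP; exists v; rewrite ?inE // def_a uE.
  have [un uvN] : u != next c v /\ u \in Nv.
    by move: uN; rewrite in_setD1 => /andP[_]; rewrite in_setD1 => /andP[].
  have up : u != prev c v by move: uN; rewrite in_setD1 => /andP[].
  have uv := nbs_neq eirr uvN.
  have [uc' euv] : u \in c /\ [set v; u] \in E by move: uvN; rewrite !inE => /andP[].
  rewrite !inE eqxx euv andbT /=; apply/andP; split.
    by apply/subsetP=> z; rewrite !inE => /orP[]/eqP->.
  apply/imsetP=> -[z zc E2].
  have : v \in [set z; next c z] by rewrite -E2 !inE eqxx.
  rewrite !inE => /orP[/eqP vz|/eqP vz].
    by rewrite -vz in E2; move/eqP: un; apply; apply: set2_injr E2 uv.
  rewrite setUC vz in E2; have /eqP := up; rewrite vz prev_next //; apply.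
  by rewrite setUC [RHS]setUC in E2; apply: (set2_injr E2); rewrite -vz.
rewrite card_in_imset => [|u u' uN _ /= /set2_injr]; last first.
  apply; apply: (nbs_neq eirr (S := C)).
  by move: uN; rewrite in_setD1 => /andP[_]; rewrite in_setD1 => /andP[].
have := cardsD1 (next c v) Nv; rewrite nN.
have := cardsD1 (prev c v) (Nv :\ next c v); rewrite in_setD1 pn pN /=; lia_nat.
Qed.

Lemma no_rich_cycleP k E : simple_graph E ->
  reflect (forall c v, cyc (adj E) c -> v \in c ->
             #|nbs (adj E) [set x in c] v| <= k.+1)
          (~~ has_rich_cycle k E).
Proof.
move=> sE; apply: (iffP idP) => [nr c v cc vc|H].
  rewrite -(chords_at_nbs sE cc vc) addn2 ltnS ltnNge; apply/negP=> kv.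
  move/negP: nr; apply; apply/has_rich_cycleP; exists c; apply/andP; split=> //.
  by apply/exists_inP; exists v.
apply/has_rich_cycleP=> -[c /andP[cc /exists_inP[v vc kv]]].
by have := H c v cc vc; rewrite -(chords_at_nbs sE cc vc); lia_nat.
Qed.

(** * Joining a graph on [A] to an independent set *)

Section Join.
Variables (A : {set T}) (E : {set {set T}}) (r : nat).
Hypotheses (sE : simple_graph E) (EA : forall a, a \in E -> a \subset A).
Hypothesis degr : forall v, deg E v <= r.

Definition cross : {set {set T}} := [set [set p.1; p.2] | p in setX A (~: A)].

Lemma cross_edge x y : [set x; y] \in cross -> (x \in A) != (y \in A).
Proof.
case/imsetP=> -[u v] /setXP[/= uA]; rewrite inE => /negPf vA E2.
have : x \in [set u; v] by rewrite -E2 !inE eqxx.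
have : y \in [set u; v] by rewrite -E2 !inE eqxx orbT.
have : u \in [set x; y] by rewrite E2 !inE eqxx.
have : v \in [set x; y] by rewrite E2 !inE eqxx orbT.
rewrite !inE => /orP[]/eqP vE /orP[]/eqP uE; rewrite -?vE -?uE ?uA ?vA //.
  by rewrite vE -uE uA in vA.
by rewrite vE -uE uA in vA.
Qed.

Lemma card_cross : #|cross| = #|A| * #|~: A|.
Proof.
rewrite card_in_imset ?cardsX // => -[x y] [x' y'] /setXP[/= xA].
rewrite inE => /negP yA /setXP[/= x'A]; rewrite inE => /negP y'A E2.
have xE : x = x'.
  have : x \in [set x'; y'] by rewrite -E2 !inE eqxx.
  by rewrite !inE => /orP[]/eqP // xy'; rewrite -xy' in y'A.
rewrite xE in E2 *; congr (_, _); apply: (set2_injr E2).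
by apply/eqP=> yx'; rewrite yx' in yA.
Qed.

Lemma edge_inside x y : [set x; y] \in E -> x \in A /\ y \in A.
Proof. by move/EA; rewrite subUset !sub1set => /andP. Qed.

Lemma join_simple : simple_graph (E :|: cross).
Proof.
apply/simpleP=> a; rewrite inE => /orP[/(simpleP _ sE)//|aX].
case/imsetP: (aX) => p _ def_a; have := cross_edge (_ : [set p.1; p.2] \in cross).
rewrite -def_a => /(_ aX) neq; rewrite def_a cards2.
by case: eqP => // pE; rewrite pE eqxx in neq.
Qed.

Lemma card_join : #|E :|: cross| = #|E| + #|A| * #|~: A|.
Proof.
rewrite cardsU disjoint_setI0 ?cards0 ?subn0 ?card_cross //.
rewrite disjoint_subset; apply/subsetP=> a aE; rewrite inE.
apply/negP=> aX; case/imsetP: (aX) => p _ def_a.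
have := aE; rewrite def_a => /edge_inside[p1 p2].
by move: aX; rewrite def_a => /cross_edge; rewrite p1 p2.
Qed.

(** Vertices outside [A] are independent, so the successor map sends those on the cycle injectively
    into [A]: a cycle contains at most [#|A|] of them. *)
Lemma join_cycle_degree c v : cyc (adj (E :|: cross)) c -> v \in c ->
  #|nbs (adj (E :|: cross)) [set x in c] v| <= r + #|A|.
Proof.
move=> cc vc; have [_ uc cyc_c] := cycP _ _ cc.
have out x y : x \notin A -> adj (E :|: cross) x y -> y \in A.
  move=> /negPf xA; rewrite /adj inE => /orP[/edge_inside[]|/cross_edge].
    by rewrite xA.
  by rewrite xA; case: (y \in A).
have [vA|vA] := boolP (v \in A); last first.
  apply: leq_trans (leq_addl _ _); apply: subset_leq_card; apply/subsetP=> u.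
  by rewrite inE => /andP[_ /(out _ _ vA)].
have sub : nbs (adj (E :|: cross)) [set x in c] v
    \subset nbs (adj E) A v :|: ([set x in c] :\: A).
  apply/subsetP=> u; rewrite !inE /adj inE => /andP[-> /orP[vu|/cross_edge]].
    by have [_ ->] := edge_inside vu; rewrite vu.
  by rewrite vA; case: (u \in A).
apply: leq_trans (subset_leq_card sub) _.
rewrite cardsU; apply: leq_trans (leq_subr _ _) _; apply: leq_add.
  by rewrite -deg_nbs.
rewrite -(card_imset _ (next_inj uc)); apply: subset_leq_card.
apply/subsetP=> y /imsetP[x]; rewrite !inE => /andP[xA xc] ->.
by apply: out xA _; apply: next_cycle.
Qed.

End Join.

Lemma regular_cycle_degree E r (c : seq T) v : simple_graph E -> (forall v, deg E v <= r) ->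
  #|nbs (adj E) [set x in c] v| <= r.
Proof.
move=> sE degr; apply: leq_trans (degr v).
rewrite (@deg_nbs E setT) //.
by apply: subset_leq_card; apply: nbsS; apply: subsetT.
Qed.

End EdgeSets.

Lemma edge_bound (T : finType) k (E : {set {set T}}) : 0 < k -> simple_graph E ->
  ~~ has_rich_cycle k E -> bounded k.+1 #|T| (2 * #|E|).
Proof.
move=> k0 sE /(no_rich_cycleP k sE) few.
have := bounded_vol (adj_sym E) (adj_irr sE) (k0 : 1 < k.+1) few setT.
rewrite cardsT -(sum_deg sE (fun a _ => subsetT a)) /vol.
by under eq_bigr do rewrite -(deg_nbs _ sE (fun a _ => subsetT a)).
Qed.

Theorem theorem1p3 (k n : nat) (hk : 1 <= k) (hn : k + 2 <= n) :
  g k n =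
  maxn ((k + 1) * n %/ 2)
       (\max_((k + 1) %/ 2 + 1 <= a < (k + 1).+1)
          (a * (n - a) + a * (k + 1 - a) %/ 2)).
Proof.
apply/eqP; rewrite eqn_leq; apply/andP; split.
  apply/bigmax_leqP=> E /andP[sE nr]; rewrite leq_max.
  have := edge_bound hk sE nr; rewrite card_ord.
  case=> [H|[a [da ad H]]]; first by apply/orP; left; lia_nat.
  apply/orP; right; apply: (@leq_trans (a * (n - a) + a * (k + 1 - a) %/ 2)).
    have : 2 * #|E| <= 2 * (a * (n - a)) + a * (k + 1 - a).
      by rewrite !mulnBr; nat_hyps; nia.
    by lia_nat.
  apply: (leq_bigmax_seq (F := fun a => a * (n - a) + a * (k + 1 - a) %/ 2)) => //.
  by rewrite mem_index_iota; lia_nat.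
rewrite geq_max; apply/andP; split.
  have [E [sE _ degE cE]] : exists E : {set {set 'I_n}}, [/\ simple_graph E,
      forall a, a \in E -> a \subset setT, forall v, deg E v <= k.+1 &
      k.+1 * #|[set: 'I_n]| <= 2 * #|E| + 1].
    by apply: near_regular; rewrite cardsT card_ord; lia_nat.
  apply: (@leq_trans #|E|); first by rewrite cardsT card_ord in cE; lia_nat.
  apply: leq_bigmax_cond; rewrite sE; apply/(no_rich_cycleP k sE) => c v _ _.
  exact: regular_cycle_degree.
apply/bigmax_leqP_seq=> a; rewrite mem_index_iota => ha _.
have [A cardA] : exists A : {set 'I_n}, #|A| = a.
  have /card_geqP[s [us <- _]] : a <= #|{: 'I_n}| by rewrite card_ord; lia_nat.
  by exists [set x in s]; rewrite cardsE; apply/card_uniqP.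
(* The lower end of the range of [a] ensures [k + 1 - a < a], as [near_regular] demands; degrees on
   a cycle of the join are then at most [(k + 1 - a) + a]. *)
have [E [sE EA degE cE]] : exists E : {set {set 'I_n}}, [/\ simple_graph E,
    forall b, b \in E -> b \subset A, forall v, deg E v <= k + 1 - a &
    (k + 1 - a) * #|A| <= 2 * #|E| + 1].
  by apply: near_regular; rewrite cardA; lia_nat.
apply: (@leq_trans #|E :|: cross A|).
  have cC : #|~: A| = n - a by rewrite cardsCs setCK card_ord cardA.
  rewrite (card_join EA) cC cardA addnC leq_add2r.
  by rewrite cardA mulnC in cE; lia_nat.
apply: leq_bigmax_cond; rewrite join_simple //.
apply/(no_rich_cycleP k (join_simple A sE)) => c v cc vc.
have := join_cycle_degree sE EA degE cc vc; rewrite cardA; lia_nat.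
Qed.
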